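(* Let $f$ be a function from positive integers to positive integers such that every planar graph $H$ satisfies $\mathrm{HG}_s(H) < f(s)$ for every integer $s \ge 1$. Then for every integer $g\ge 0$ and every integer $s\ge 1$, every graph $G$ of genus $g$ satisfies $\mathrm{HG}_s(G) < f\bigl(3^{2(6^g - 1)} s^{6^g}\bigr)$.
   Context: All graphs are finite and simple. For an integer $s\ge1$, $\mathrm{HG}_s(G)$ is the maximum $k$ such that, with color set $\{1,\dots,k\}$, there is a strategy (each vertex $v$ has a function mapping each coloring of its neighborhood $N(v)$ to a set of at most $s$ colors) such that for every coloring $\phi:V(G)\to\{1,\dots,k\}$ some vertex $v$ has $\phi(v)$ in the set its function assigns to $\phi|_{N(v)}$. The genus of a graph is the minimum genus of a surface on which it embeds. *)

(* Defs.v *)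
From mathcomp Require Import all_boot all_fingroup.

Set Implicit Arguments.
Unset Strict Implicit.
Unset Printing Implicit Defensive.

Record sgraph := SGraph {
  vertex :> finType;
  adj : rel vertex;
  adj_sym : symmetric adj;
  adj_irrefl : irreflexive adj
}.

Section HatGuessing.
Variable G : sgraph.

Definition nbh (v : G) : finType := {u : G | adj v u}.

Definition restrict_nbh k (phi : {ffun G -> 'I_k}) (v : G) :
  {ffun nbh v -> 'I_k} := [ffun u => phi (val u)].

Definition strategy k : finType :=
  {dffun forall v : G, {ffun {ffun nbh v -> 'I_k} -> {set 'I_k}}}.

(* The color set is 'I_k, i.e. {0, ..., k - 1} in place of {1, ..., k}. *)
Definition hat_winnable s k : bool :=
  [exists g : strategy k,
     [forall v, forall c, #|g v c| <= s] &&
     [forall phi : {ffun G -> 'I_k},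
        exists v, phi v \in g v (restrict_nbh phi v)]].

Lemma hat_winnableP s k :
  reflect (exists g : forall v : G, {ffun nbh v -> 'I_k} -> {set 'I_k},
             (forall v c, #|g v c| <= s) /\
             forall phi : {ffun G -> 'I_k},
               exists v, phi v \in g v (restrict_nbh phi v))
          (hat_winnable s k).
Proof.
apply: (iffP existsP) => [[g /andP[/forallP g_s /forallP g_w]]|[g [g_s g_w]]].
  exists (fun v c => g v c); split=> [v c|phi]; last exact/existsP/g_w.
  exact: (forallP (g_s v)).
exists [ffun v : G => [ffun c => g v c]]; apply/andP; split.
  by apply/forallP=> v; apply/forallP=> c; rewrite !ffunE; exact: g_s.
apply/forallP=> phi; apply/existsP; have [v v_ok] := g_w phi.
by exists v; rewrite !ffunE.
Qed.

(* For a fixed strategy, each vertex guesses correctly on at most a fraction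
   s / k of all colorings. *)
Lemma hat_winnable_bound s k : hat_winnable s k -> k <= s * #|G|.
Proof.
case/hat_winnableP=> g [g_s g_w]; case: k g g_s g_w => // k g g_s g_w.
pose C := {ffun G -> 'I_k.+1}.
pose upd (phi : C) v c : C := [ffun u => if u == v then c else phi u].
pose B v := [set phi : C | phi v \in g v (restrict_nbh phi v)].
have restr_upd phi v c : restrict_nbh (upd phi v c) v = restrict_nbh phi v.
  apply/ffunP=> u; rewrite !ffunE; case: eqP => // u_v.
  by have := valP u; rewrite u_v adj_irrefl.
have C_gt0 : 0 < #|C| by apply/card_gt0P; exists [ffun=> ord0].
have B_bound v : #|B v| * k.+1 <= s * #|C|.
  pose F (p : C * 'I_k.+1) := (upd p.1 v p.2, p.1 v).
  have F_inj : injective F.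
    move=> [p c] [q d] F_eq; have /= eq_v := congr1 snd F_eq.
    have /= eq_upd := congr1 fst F_eq.
    have eq_u u : upd p v c u = upd q v d u by rewrite eq_upd.
    congr (_, _); last by have:= eq_u v; rewrite !ffunE eqxx.
    by apply/ffunP=> u; have:= eq_u u; rewrite !ffunE; case: eqP => [->|].
  have -> : #|B v| * k.+1 = #|F @: setX (B v) [set: 'I_k.+1]|.
    by rewrite card_imset // cardsX cardsT card_ord.
  pose T := [set q : C * 'I_k.+1 | q.2 \in g v (restrict_nbh q.1 v)].
  have FT : F @: setX (B v) setT \subset T.
    apply/subsetP=> _ /imsetP[[p c] p_ok ->].
    by move: p_ok; rewrite !inE /= andbT restr_upd.
  apply: leq_trans (subset_leq_card FT) _; rewrite -sum1_card.
  rewrite (eq_bigl (fun q : C * 'I_k.+1 =>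
    xpredT q.1 && (q.2 \in g v (restrict_nbh q.1 v)))); last first.
    by move=> q; rewrite inE.
  rewrite -(pair_big_dep xpredT (fun p c => c \in g v (restrict_nbh p v))
             (fun _ _ => 1)) /= mulnC -sum_nat_const.
  by apply: leq_sum => p _; rewrite sum1_card.
have cover : #|C| <= \sum_(v : G) #|B v|.
  have -> : \sum_v #|B v| = \sum_v \sum_phi (phi \in B v).
    by apply: eq_bigr => v _; rewrite -sum1_card big_mkcond.
  rewrite -sum1_card exchange_big /=; apply: leq_sum => phi _; have [v v_ok] := g_w phi.
  by rewrite (bigD1 v) //= inE v_ok.
rewrite -(leq_pmul2l C_gt0) (leq_trans (leq_mul cover (leqnn _))) //.
rewrite big_distrl /= mulnC -mulnA mulnCA -sum_nat_const.
by apply: leq_sum => v _; exact: B_bound.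
Qed.

(* The search range is no restriction, by hat_winnable_bound; see HG_max.  The
   value is 0 on the graph without vertices, where no k is winnable. *)
Definition HG s : nat :=
  \max_(k < (s * #|G|).+1 | hat_winnable s k) k.

Lemma HG_max s k : hat_winnable s k -> k <= HG s.
Proof.
move=> k_win; have k_lt : k < (s * #|G|).+1 by exact: hat_winnable_bound.
exact: (leq_bigmax_cond (Ordinal k_lt)).
Qed.

Lemma HG_winnable s : 0 < #|G| -> hat_winnable s (HG s).
Proof.
move=> /card_gt0P[v0 _].
have win0 : hat_winnable s 0.
  apply/hat_winnableP; exists (fun _ _ => set0); split=> [v c|phi].
    by rewrite cards0.
  by case: (phi v0).
have [k k_win HG_k] := @eq_bigmax_cond _ [pred k : 'I_(s * #|G|).+1 |
  hat_winnable s k] (fun k => k : nat) (introT card_gt0P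
    (ex_intro _ ord0 win0)).
by rewrite (HG_k : HG s = k).
Qed.

End HatGuessing.

(* A cell decomposition of a connected closed oriented surface, encoded on its
   darts (edges with a direction): [edge] reverses a dart, and [node] rotates
   a dart to the next one leaving the same vertex.  Vertices, edges and faces
   are the cycles of [node], of [edge], and of their composite.  Loops
   and multiple edges are allowed. *)
Record surface_map := SurfaceMap {
  dart :> finType;
  node : {perm dart};
  edge : {perm dart};
  edgeK : involutive edge;
  edge_neq : forall d, edge d != d;
  map_connected : [transitive <<[set node; edge]>>, on [set: dart] | 'P]%act
}.

Definition nodes (M : surface_map) : {set {set M}} := porbits (node M).
Definition edges (M : surface_map) : {set {set M}} := porbits (edge M).
Definition faces (M : surface_map) : {set {set M}} :=
  porbits (edge M * node M)%g.

(* Euler's formula V - E + F = 2 - 2g, without subtraction. *)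
Definition has_surface_genus (M : surface_map) (g : nat) : Prop :=
  #|nodes M| + #|faces M| + 2 * g = #|edges M| + 2.

(* G is a subgraph of the 1-skeleton of M.  As G is simple, distinct edges of G
   are then carried by distinct edges of M. *)
Definition drawn_on (G : sgraph) (M : surface_map) : Prop :=
  exists h : G -> {set M},
    [/\ injective h,
        forall v, h v \in nodes M
      & forall u v, adj u v -> exists2 d, d \in h u & edge M d \in h v].

(* G itself need not be cellularly embedded, nor connected: any drawing of G on
   a surface extends to the 1-skeleton of a cell decomposition once enough
   vertices and edges are added in its complement. *)
Definition embeds_in_genus (G : sgraph) (g : nat) : Prop :=
  exists2 M, has_surface_genus M g & drawn_on G M.

Definition graph_genus (G : sgraph) (g : nat) : Prop :=
  embeds_in_genus G g /\ forall h, embeds_in_genus G h -> g <= h.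

(* Planarity as embeddability in the sphere. *)
Definition planar (G : sgraph) : Prop := embeds_in_genus G 0.

(* Main.v *)
Require Import Defs.
From mathcomp Require Import all_boot.
From mathcomp Require Import all_fingroup all_algebra zify.

Set Implicit Arguments.
Unset Strict Implicit.
Unset Printing Implicit Defensive.

(* Induction on g.  Let G be drawn on a map M of genus g + 1, and count chains of
   edges modulo 2.  As the homology of M is nonzero, linear algebra leaves two
   cases.

   If some closed chain in the drawing of G does not bound, let z be a smallest
   one.  It is a simple cycle, and M remains connected when cut along it, so that
   capping the two holes gives a map of genus g on which G minus the vertices A
   of z is drawn.  By minimality, shortcuts between vertices of z are impossible:
   a vertex outside A has at most 5 neighbors in A, and one in A at most 2.
   Let the vertices of A use 9 s colors only.  Each other vertex then guesses
   for all of the at most (9 s)^5 colorings of its neighbors in A at once, and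
   if all these guesses fail, the local lemma gives a coloring of A on which
   A fails too.  Hence s becomes s (9 s)^5 = 3^10 s^6.

   Otherwise some nontrivial closed chain of the dual map avoids G, and cutting
   the dual map along it draws G itself on a map of genus g. *)

(** * Hat guessing *)

Lemma hat_winnable_mono (G : sgraph) s t k :
  s <= t -> hat_winnable G s k -> hat_winnable G t k.
Proof.
move=> le_st /hat_winnableP[g [g_s g_w]]; apply/hat_winnableP; exists g.
by split=> // v c; apply: leq_trans (g_s v c) le_st.
Qed.

Lemma HG_mono (G : sgraph) s t : s <= t -> HG G s <= HG G t.
Proof.
move=> le_st; apply/bigmax_leqP => k k_win.
exact/HG_max/(hat_winnable_mono le_st).
Qed.

Lemma HG_bound (G : sgraph) s : HG G s <= s * #|G|.
Proof. by apply/bigmax_leqP => k /hat_winnable_bound. Qed.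

(** * The local lemma on the deleted vertices *)

Section LosingColoring.
Variables (T : finType) (e : rel T) (A : {set T}) (s L : nat).
Hypothesis e_sym : symmetric e.
Hypothesis e_irr : irreflexive e.
Hypothesis degA : forall a, a \in A -> #|[set b in A | e a b]| <= 2.
Variable guess : T -> {ffun T -> 'I_L} -> {set 'I_L}.
Hypothesis guess_local : forall a (p q : {ffun T -> 'I_L}),
  (forall b, e a b -> p b = q b) -> guess a p = guess a q.
Hypothesis guess_card : forall a p, #|guess a p| <= s.
Hypothesis s_L : 9 * s <= L.
Hypothesis L_gt0 : 0 < L.

Let good (S : {set T}) := [set p : {ffun T -> 'I_L} |
  [forall a in S, p a \notin guess a p]].

Let recolor (p : {ffun T -> 'I_L}) a c : {ffun T -> 'I_L} :=
  [ffun u => if u == a then c else p u].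

(** Recoloring [a] changes neither the guess of [a] nor any guess made on [S]. So the color of [a]
    is independent of both, and at most [s] of its [L] values are guessed. *)
Let wrong_guess_count (S : {set T}) a : a \notin S -> (forall b, b \in S -> ~~ e a b) ->
  #|[set p in good S | p a \in guess a p]| * L <= s * #|good S|.
Proof.
move=> aS naS; set B := [set p in _ | _].
have guess_rec p c b : ~~ e b a -> guess b (recolor p a c) = guess b p.
  by move=> nba; apply: guess_local => u bu; rewrite ffunE; case: eqP => // ua;
    rewrite -ua bu in nba.
have good_rec p c : (recolor p a c \in good S) = (p \in good S).
  rewrite !inE; apply: eq_forallb => b; case bS: (b \in S) => //=.
  rewrite guess_rec ?ffunE; last by rewrite e_sym naS.
  by case: eqP => // ba; rewrite -ba bS in aS.
rewrite {}/B; move: (good S) good_rec => GS good_rec; set B := [set p in _ | _].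
pose F (q : {ffun T -> 'I_L} * 'I_L) := (recolor q.1 a q.2, q.1 a).
have F_inj : injective F.
  move=> [p c] [q d] F_eq; have /= eq_a := congr1 snd F_eq.
  have /= /ffunP eq_r := congr1 fst F_eq.
  congr (_, _); last by have:= eq_r a; rewrite !ffunE eqxx.
  by apply/ffunP=> u; have:= eq_r u; rewrite !ffunE; case: eqP => [->|].
have -> : #|B| * L = #|F @: setX B [set: 'I_L]|.
  by rewrite card_imset // cardsX cardsT card_ord.
apply: (@leq_trans #|[set q : {ffun T -> 'I_L} * 'I_L |
           (q.1 \in GS) && (q.2 \in guess a q.1)]|).
  apply: subset_leq_card; apply/subsetP=> _ /imsetP[[p c] p_ok ->].
  by move: p_ok; rewrite !inE /= andbT good_rec guess_rec ?e_irr.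
rewrite -sum1_card (eq_bigl (fun q : {ffun T -> 'I_L} * 'I_L =>
  (q.1 \in GS) && (q.2 \in guess a q.1))); last by move=> q; rewrite inE.
rewrite -(pair_big_dep (mem GS) (fun p c => c \in guess a p)
           (fun _ _ => 1)) /= mulnC -sum_nat_const.
by apply: leq_sum => p _; rewrite sum1_card.
Qed.

(* The local lemma by counting: 3/4 = 1 - x, where x = 1/4 satisfies
   1/9 <= x (1 - x)^2. *)
Let good_step (S : {set T}) a : S \subset A -> a \in A -> a \notin S ->
  3 * #|good S| <= 4 * #|good (a |: S)|.
Proof.
have [n] := ubnP #|S|; elim: n S a => // n IHn S a leSn SA aA aS.
set S0 := [set b in S | ~~ e a b].
(* The neighbors of [a] in [S] are put back one at a time; the outer induction applies to each,
   since [R :\ b] is smaller than [S], and costs a factor 3/4. *)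
have grow (R : {set T}) : R \subset S -> S0 \subset R ->
    3 ^ #|R :\: S0| * #|good S0| <= 4 ^ #|R :\: S0| * #|good R|.
  have [m] := ubnP #|R :\: S0|; elim: m R => // m IHm R leRm RS S0R.
  have [E0|[b bR]] := set_0Vmem (R :\: S0).
    rewrite E0 cards0 !mul1n (_ : R = S0) //; apply/eqP.
    by rewrite eqEsubset S0R -setD_eq0 E0 eqxx.
  have bR' : b \in R by case/setDP: bR.
  have bS0 : b \notin S0 by case/setDP: bR.
  have S0Rb : S0 \subset R :\ b.
    by apply/subsetP => c cS0; rewrite !inE (subsetP S0R) // andbT;
      apply: contraNneq bS0 => <-.
  have RbS : R :\ b \subset S by apply: subset_trans RS; apply: subsetDl.
  have Ecard : #|R :\: S0| = #|R :\ b :\: S0|.+1.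
    rewrite (cardsD1 b) bR add1n; congr (_.+1); apply: eq_card => c.
    by rewrite !inE; bool_congr; rewrite andbC.
  have ltRb : #|R :\ b| < #|S|.
    apply: leq_trans (subset_leq_card RS); by rewrite [in X in _ < X](cardsD1 b) bR'.
  have := IHm (R :\ b) _ RbS S0Rb.
  rewrite Ecard !expnS => /(_ _); rewrite -ltnS -Ecard => /(_ leRm) IH1.
  have := IHn (R :\ b) b (leq_trans ltRb _) (subset_trans RbS SA) _ _.
  rewrite setD1K // !inE eqxx (subsetP SA) ?(subsetP RS) //.
  move/(_ leSn isT isT) => IH2.
  rewrite -mulnA (leq_trans (leq_mul (leqnn 3) IH1)) // mulnCA.
  by rewrite [4 * _]mulnC -mulnA leq_mul2l IH2 orbT.
have S0S : S0 \subset S by apply/subsetP => c; rewrite inE => /andP[].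
have := grow S (subxx _) S0S.
have deg : #|S :\: S0| <= 2.
  apply: leq_trans (degA aA); apply: subset_leq_card; apply/subsetP => c.
  rewrite !inE => /andP[]; rewrite negb_and negbK => /orP[/negbTE-> //|ac cS].
  by rewrite (subsetP SA) // ac.
have W := @wrong_guess_count S0 a _ _.
have {}W : #|[set p in good S0 | p a \in guess a p]| * L <= s * #|good S0|.
  by apply: W => [|b]; rewrite inE ?(negbTE aS) // => /andP[].
have split_good : #|good S| <= #|good (a |: S)| + #|[set p in good S0 | p a \in guess a p]|.
  apply: leq_trans (leq_card_setU _ _); apply: subset_leq_card.
  apply/subsetP => p; rewrite !inE => /forallP pS.
  case pa: (p a \in _); rewrite ?andbT ?andbF ?orbF.
    apply/orP; right; apply/forallP => b; apply/implyP; rewrite inE => /andP[bS _].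
    by have := pS b; rewrite bS.
  apply/forallP => b; apply/implyP; rewrite !inE => /orP[/eqP->|bS].
    by rewrite pa.
  by have := pS b; rewrite bS.
move=> G0; set x := #|good S| in G0 split_good *.
set y := #|good (a |: S)| in split_good *.
set w := #|[set p in good S0 | _]| in W split_good; set x0 := #|good S0| in W G0.
(* At most two neighbors were left out, so [x0] is at most 16/9 of [x]. As [x <= y + w] and
   [9 w <= x0], the loss [x - y] is at most 16/81 of [x], less than a quarter. *)
have {}G0 : 9 * x0 <= 16 * x by case: #|_ :\: _| deg G0 => [|[|[|]]] //= _; lia.
have {}W : 9 * w <= x0.
  rewrite -(leq_pmul2r L_gt0); nia.
lia.
Qed.

(** By [good_step] each vertex of [A] in turn keeps at least three quarters of the good colorings,
    so some coloring survives all of [A]. *)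
Lemma losing_coloring : exists p : {ffun T -> 'I_L},
  forall a, a \in A -> p a \notin guess a p.
Proof.
suff: 0 < #|good A|.
  case/card_gt0P => p; rewrite inE => /forallP pA; exists p => a aA.
  by have := pA a; rewrite aA.
suff: forall S : {set T}, S \subset A -> 0 < #|good S| by exact.
move=> S; have [n] := ubnP #|S|; elim: n S => // n IHn S leSn SA.
have [->|[a aS]] := set_0Vmem S.
  apply/card_gt0P; exists [ffun=> Ordinal L_gt0]; rewrite inE.
  by apply/forallP => a; rewrite inE.
have SaA : S :\ a \subset A by apply: subset_trans SA; apply: subsetDl.
have := @good_step (S :\ a) a SaA (subsetP SA _ aS) _; rewrite setD1K // !inE eqxx.
have ltn : #|S :\ a| < n by move: leSn; rewrite (cardsD1 a) aS add1n ltnS.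
by have := IHn _ ltn SaA; move=> ? /(_ isT); lia.
Qed.

End LosingColoring.

(** * Deleting a set of vertices *)

Section Induced.
Variables (G : sgraph) (A : {set G}).
Let W : finType := {v : G | v \notin A}.
Definition del_adj : rel W := fun u v => adj (val u) (val v).
Lemma del_adj_sym : symmetric del_adj. Proof. by move=> u v; apply: adj_sym. Qed.
Lemma del_adj_irrefl : irreflexive del_adj. Proof. by move=> u; apply: adj_irrefl. Qed.
Definition delete_set : sgraph := SGraph del_adj_sym del_adj_irrefl.
End Induced.

Section Extension.
Variables (G : sgraph) (A : {set G}) (s k L : nat).
Hypothesis inner : forall a, a \in A -> #|[set b in A | adj a b]| <= 2.
Hypothesis outer : forall v, v \notin A -> #|[set b in A | adj v b]| <= 5.
Hypothesis s_L : 9 * s <= L.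
Hypothesis L_gt0 : 0 < L.
Hypothesis L_k : L <= k.

Let H := delete_set A.
Let lst (c : 'I_L) : 'I_k := widen_ord L_k c.

Let merge (v : G) (c : {ffun nbh v -> option 'I_k}) (p : {ffun G -> 'I_L}) :
  {ffun nbh v -> 'I_k} := [ffun u => odflt (lst (p (val u))) (c u)].

(* The colors outside [A] as seen from [v]; [None] on [A]. *)
Let seen (v : H) (c : {ffun nbh v -> 'I_k}) : {ffun nbh (val v) -> option 'I_k} :=
  [ffun u : nbh (val v) =>
    if insub (val u) is Some w then
      if insub (w : H) is Some w' then Some (c w') else None
    else None].

Let glue (phi : {ffun H -> 'I_k}) (p : {ffun G -> 'I_L}) : {ffun G -> 'I_k} :=
  [ffun u => if insub u is Some w then phi (w : H) else lst (p u)].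

Let merge_seen (v : H) phi p :
  merge (seen (restrict_nbh phi v)) p = restrict_nbh (glue phi p) (val v).
Proof.
apply/ffunP => u; rewrite !ffunE; case: insubP => [w wA wu|//].
case: insubP => [w' w'v w'w|]; first by rewrite ffunE w'w.
by rewrite /= /del_adj wu (valP u).
Qed.

Lemma hat_winnable_delete_set :
  hat_winnable G s k -> hat_winnable H (s * L ^ 5) k.
Proof.
move=> /hat_winnableP[g [g_s g_w]]; apply/hat_winnableP.
pose NA (v : G) := [set b in A | adj v b].
pose dflt : 'I_L := Ordinal L_gt0.
(* [pffun_on] forces the value [dflt] off the neighbors of [v] in [A], so that the union has at most
   [L ^ 5] members and not one for each coloring of [G]. *)
exists (fun (v : H) c =>
  \bigcup_(p in pffun_on dflt (mem (NA (val v))) predT) g (val v) (merge (seen c) p)).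
split=> [v c|phi].
  apply: (@leq_trans (\sum_(p in pffun_on dflt (mem (NA (val v))) predT) s)).
    elim/big_ind2: _ => [|x1 X1 x2 X2 l1 l2|p _]; rewrite ?cards0 //.
    by apply: leq_trans (leq_card_setU _ _) _; apply: leq_add.
  rewrite sum_nat_const mulnC leq_mul2l card_pffun_on cardT size_enum_ord.
  by rewrite leq_pexp2l ?orbT ?outer // (valP v).
have [/existsP//|/existsPn lose] := boolP [exists v : H, phi v \in
  \bigcup_(p in pffun_on dflt (mem (NA (val v))) predT)
     g (val v) (merge (seen (restrict_nbh phi v)) p)].
(* With the colors [phi] outside [A] fixed, the guesses on [A] depend on [p] alone; only guesses
   among the first [L] colors can be right. *)
pose guess (a : G) (p : {ffun G -> 'I_L}) : {set 'I_L} :=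
  [set c | lst c \in g a (restrict_nbh (glue phi p) a)].
have [||p p_lose] :=
  @losing_coloring G (@adj G) A s L (@adj_sym G) (@adj_irrefl G) inner guess _ _ s_L L_gt0.
- move=> a p q pq; apply/setP => c; rewrite !inE; congr (_ \in g a _).
  apply/ffunP => u; rewrite !ffunE; case: insubP => // _.
  by rewrite (pq (val u)) // (valP u).
- move=> a p; apply: leq_trans (g_s a (restrict_nbh (glue phi p) a)).
  rewrite -(card_imset (mem (guess a p)) (f := lst)); last first.
    by move=> c d /(congr1 val) cd; apply: val_inj.
  by apply: subset_leq_card; apply/subsetP => _ /imsetP[c cg ->]; rewrite inE in cg.
have [v] := g_w (glue phi p); rewrite ffunE; case: insubP => [w wA wv|]; last first.
  by rewrite negbK => vA vg; have := p_lose v vA; rewrite inE vg.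
rewrite -wv => wg; have := lose w; rewrite (_ : _ \in _) //.
(* [q] agrees with [p] wherever [w] sees [A], so the guess of [w] is the same, and [q] is one of the
   colorings over which the union runs. *)
pose q : {ffun G -> 'I_L} := [ffun u => if u \in NA (val w) then p u else dflt].
apply/bigcupP; exists q.
  apply/pffun_onP; split=> //; apply/subsetP => u; rewrite inE ffunE.
  by case: ifP => //; rewrite eqxx.
rewrite merge_seen (_ : restrict_nbh _ _ = restrict_nbh (glue phi p) (val w)) //.
apply/ffunP => u; rewrite !ffunE; case: insubP => // uA.
by rewrite inE -[_ \in A]negbK uA (valP u).
Qed.

End Extension.

(** * Cycles of permutations *)

Section Orbits.
Implicit Types T A B : finType.
Local Open Scope group_scope.

Lemma porbit_map A B (i : A -> B) (p : {perm A}) (q : {perm B}) x :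
  (forall y, y \in porbit p x -> q (i y) = i (p y)) ->
  porbit q (i x) = i @: porbit p x.
Proof.
move=> qi.
have qXi n : (q ^+ n) (i x) = i ((p ^+ n) x).
  elim: n => [|n IHn]; first by rewrite !expg0 !perm1.
  by rewrite !expgSr !permM IHn qi ?mem_porbit.
apply/setP => y; apply/idP/imsetP.
  by case/porbitP => n ->; exists ((p ^+ n) x); rewrite ?mem_porbit.
by case=> _ /porbitP[n ->] ->; rewrite -qXi mem_porbit.
Qed.

Lemma porbit_step T (p : {perm T}) x : p x \in porbit p x.
Proof. by have := mem_porbit p 1 x; rewrite expg1. Qed.

Lemma eq_porbits T (p : {perm T}) (x y : T) :
  y \in porbit p x -> porbit p y = porbit p x.
Proof. by move=> xy; apply/eqP; rewrite eq_porbit_mem. Qed.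

Lemma porbit_closed T (p : {perm T}) (K : pred T) x y :
  (forall z, K (p z) = K z) -> y \in porbit p x -> K y = K x.
Proof.
move=> Kp /porbitP[n ->]; elim: n => [|n IHn]; first by rewrite expg0 perm1.
by rewrite expgSr permM Kp.
Qed.

Lemma porbit_involution T (e : {perm T}) x :
  involutive e -> porbit e x = [set x; e x].
Proof.
move=> eK; apply/setP => y; rewrite !inE; apply/idP/orP => [/porbitP[n ->]|].
  elim: n => [|n IHn]; first by rewrite expg0 perm1 eqxx; left.
  rewrite expgSr permM; case: IHn => /eqP->; first by right.
  by rewrite eK; left.
by case=> /eqP->; rewrite ?porbit_id ?porbit_step.
Qed.

Lemma card_porbits_involution T (e : {perm T}) :
  involutive e -> (forall x, e x != x) -> #|porbits e|.*2 = #|T|.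
Proof.
move=> eK e_neq.
have := @card_uniform_partition _ 2 (porbits e) [set: T] _ _.
rewrite cardsT muln2 => -> //.
  by move=> _ /imsetP[x _ ->]; rewrite porbit_involution // cards2 eq_sym e_neq.
apply/and3P; split.
- rewrite eqEsubset subsetT; apply/subsetP => x _; apply/bigcupP.
  by exists (porbit e x); rewrite ?porbit_id ?imset_f.
- apply/trivIsetP => _ _ /imsetP[x _ ->] /imsetP[y _ ->] neq.
  rewrite -setI_eq0; apply/set0Pn => -[z]; rewrite inE => /andP[zx zy].
  by rewrite -(eq_porbits zx) -(eq_porbits zy) eqxx in neq.
- by apply/imsetP => -[x _ /setP/(_ x)]; rewrite inE porbit_id.
Qed.

(* Each transposition exchanging two points of one cycle splits it in two. *)
Lemma card_porbits_split T (t s : {perm T}) :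
    involutive t -> (forall x, t x \in porbit s x) ->
    (forall x y, t x != x -> t y != y -> y \in porbit s x -> y = x \/ y = t x) ->
  #|porbits (t * s)|.*2 = #|porbits s|.*2 + #|[set x | t x != x]|.
Proof.
have [n] := ubnP #|[set x | t x != x]|; elim: n t => // n IHn t leSn tK ts t2.
have [t0|[x]] := set_0Vmem [set x | t x != x].
  rewrite t0 cards0 addn0 (_ : t = 1) ?mul1g //.
  by apply/permP => x; move/setP/(_ x): t0; rewrite !inE perm1 => /eqP.
(* One transposition is peeled off [t]: [u] fixes [x] and [t x] and agrees with [t] elsewhere. *)
rewrite inE => tx; pose u := tperm x (t x) * t.
have uE y : u y = if t y == y then y else if y \in [set x; t x] then y else t y.
  rewrite permM !inE; case: tpermP => [->|->|/eqP xy /eqP txy].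
  - by rewrite (negbTE tx) eqxx.
  - by rewrite tK eq_sym (negbTE tx) eqxx orbT.
  by rewrite (negbTE xy) (negbTE txy); case: eqP.
have tE : t = tperm x (t x) * u by rewrite mulgA tperm2 mul1g.
have uneq y : (u y != y) = (t y != y) && (y \notin [set x; t x]).
  rewrite uE; case: (eqVneq (t y) y) => [_|ty]; first by rewrite eqxx.
  by case: ifP; rewrite ?eqxx ?ty.
(* The only points that [t] moves on this cycle are [x] and [t x], and [u] fixes both. So the cycle
   is still whole for [u * s], and the transposition then splits it. *)
have orbx : porbit (u * s) x = porbit s x.
  rewrite -[RHS]imset_id -(@porbit_map _ _ id s (u * s)) // => y yx; rewrite permM uE.
  case: eqP => // /eqP ty; case: (t2 x y tx ty yx) => ->; by rewrite !inE eqxx ?orbT.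
have := porbits_mul_tperm (u * s) x (t x); rewrite /= mulgA -tE.
rewrite eq_sym tx porbit_sym orbx ts addn0 addn1 => ->.
have uE2 : [set y | t y != y] = x |: (t x |: [set y | u y != y]).
  apply/setP => y; rewrite !inE uneq !inE negb_or.
  case: (eqVneq y x) => [->|_]; first by rewrite tx.
  by case: (eqVneq y (t x)) => [->|_]; rewrite ?andbT // tK eq_sym tx.
have uE3 : #|[set y | t y != y]| = #|[set y | u y != y]|.+2.
  by rewrite uE2 !cardsU1 !inE !uneq !inE !eqxx ?orbT ?andbF ?orbF eq_sym tx.
rewrite doubleS IHn ?uE3 ?addnS //.
- by move: leSn; rewrite uE3; lia.
- move=> y; rewrite [u y]uE.
  case: (eqVneq (t y) y) => [ty|ty]; first by rewrite uE ty eqxx.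
  case: ifP => yx; first by rewrite uE (negbTE ty) yx.
  rewrite uE tK eq_sym (negbTE ty) (_ : t y \in _ = false) // -yx !inE.
  by rewrite (inj_eq perm_inj) (can2_eq tK tK) orbC.
- by move=> y; rewrite uE; do !case: ifP => _; rewrite ?porbit_id ?ts.
move=> y z; rewrite !uneq => /andP[ty ynx] /andP[tz _] yz.
by case: (t2 y z ty tz yz) => ->; [left|right; rewrite uE (negbTE ty) (negbTE ynx)].
Qed.

(* [q] is [p] with extra points inserted into its cycles. *)
Lemma card_porbits_insert A B (i : A -> B) (p : {perm A}) (q : {perm B}) :
    injective i -> (forall b, exists a, b = i a \/ q b = i a) ->
    (forall a, q (i a) = i (p a) \/ q (q (i a)) = i (p a) /\ q (i a) \notin codom i) ->
  #|porbits q| = #|porbits p|.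
Proof.
move=> i_inj cov qi.
have qi_orb a n : i ((p ^+ n) a) \in porbit q (i a).
  elim: n => [|n IHn]; first by rewrite expg0 perm1 porbit_id.
  rewrite -(eq_porbits IHn) expgSr permM.
  case: (qi ((p ^+ n) a)) => [<-|[<- _]]; first by rewrite porbit_step.
  by rewrite -permM -[q * q]/(q ^+ 2) mem_porbit.
(* One step of [p] takes one or two steps of [q], hence the strong induction on the exponent. *)
have iq_orb a n : forall b, i b = (q ^+ n) (i a) -> b \in porbit p a.
  have [m] := ubnP n; elim: m n a => // m IHm [|n] a lenm b.
    by rewrite expg0 perm1 => /i_inj->; rewrite porbit_id.
  have pa : porbit p (p a) = porbit p a by exact/eq_porbits/porbit_step.
  rewrite expgS permM; case: (qi a) => [->|[qqi nqi]].
    by move/IHm; rewrite pa; apply; lia.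
  case: n lenm => [|n] lenm; first by rewrite expg0 perm1 => e; rewrite -e codom_f in nqi.
  by rewrite expgS permM qqi => /IHm; rewrite pa; apply; lia.
have orbE a : i @^-1: porbit q (i a) = porbit p a.
  apply/setP => b; rewrite inE; apply/porbitP/idP => [[n /iq_orb//]|/porbitP[n ->]].
  exact/porbitP.
(* Taking preimages under [i] is a bijection of the cycles: every cycle of [q] meets the image of
   [i], so its preimage determines it. *)
have -> : porbits p = (fun O : {set B} => i @^-1: O) @: porbits q.
  apply/setP => O; apply/imsetP/imsetP.
    by case=> a _ ->; exists (porbit q (i a)); rewrite ?orbE ?imset_f.
  case=> _ /imsetP[b _ ->] ->; have [a ab] := cov b.
  exists a => //; rewrite -orbE; suff -> : porbit q b = porbit q (i a) by [].
  case: ab => [->//|<-]; exact: esym (eq_porbits (porbit_step q b)).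
rewrite card_in_imset // => _ _ /imsetP[b _ ->] /imsetP[c _ ->] /setP bc.
have meet d : exists2 a, i a \in porbit q d & porbit q d = porbit q (i a).
  have [a [->|ad]] := cov d; exists a; rewrite ?porbit_id //.
    by rewrite -ad porbit_step.
  by apply/esym; apply: eq_porbits; rewrite -ad porbit_step.
have [a ab ->] := meet b; have := bc a; rewrite !inE ab => /esym ac.
exact: eq_porbits.
Qed.

End Orbits.

(** * Cutting a map along a cycle *)

Definition face (M : surface_map) : {perm M} := (edge M * node M)%g.

Lemma faceE (M : surface_map) (d : M) : face M d = node M (edge M d).
Proof. by rewrite permM. Qed.

Lemma nodeE (M : surface_map) (d : M) : node M d = face M (edge M d).
Proof. by rewrite faceE edgeK. Qed.

(** Sets closed under both permutations are unions of orbits. In this form connectivity passes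
    between maps without handling words in the generators. *)
Lemma connected_closed (D : finType) (n e : {perm D}) :
  reflect ((exists d : D, true) /\ forall K : {set D},
     (forall d, (n d \in K) = (d \in K)) -> (forall d, (e d \in K) = (d \in K)) ->
     K = set0 \/ K = setT)
  [transitive <<[set n; e]>>%g, on [set: D] | 'P]%act.
Proof.
apply: (iffP idP) => [tr|[[d _] allK]].
  split=> [|K Kn Ke]; first by case/imsetP: tr => d; exists d.
  have actK : [acts <<[set n; e]>>%g, on K | 'P].
    rewrite gen_subG; apply/subsetP => s; rewrite !inE => sne.
    by apply/subsetP => d dK; rewrite inE /= apermE; case/orP: sne => /eqP->;
       rewrite ?Kn ?Ke.
  have [->|[d dK]] := set_0Vmem K; [by left|right].
  apply/setP => d'; rewrite inE.
  have : d' \in orbit 'P <<[set n; e]>>%g d by rewrite (atransP tr) ?inE.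
  by case/orbitP => s s_in <-; rewrite (acts_act actK).
have dO : d \in orbit 'P <<[set n; e]>>%g d by apply: orbit_refl.
apply/imsetP; exists d => //.
have orb s : s \in [set n; e] -> forall d',
  (s d' \in orbit 'P <<[set n; e]>>%g d) = (d' \in orbit 'P <<[set n; e]>>%g d).
  move=> s_in d'; rewrite -[s d']/('P%act d' s) !(orbit_sym _ _ _ d).
  by rewrite -!orbit_eq_mem orbit_act ?mem_gen.
case: (allK (orbit 'P <<[set n; e]>>%g d)) => [||O0|->] //.
- by apply: orb; rewrite !inE eqxx.
- by apply: orb; rewrite !inE eqxx orbT.
by rewrite O0 inE in dO.
Qed.

(* Here [s] runs along the cycle [z] in one of its two directions.  The map is
   cut along [z]: each dart [c] of [z] gets a copy [inr c], so that the edges of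
   [z] are doubled, each vertex of [z] is split in two, and the two orbits of [s]
   become new faces.  The old faces do not change. *)
Section Surgery.
Variables (M : surface_map) (z : {set M}) (t : {perm M}) (c : M).
Let s : {perm M} := (edge M * t)%g.
Hypothesis z_edge : forall d, (edge M d \in z) = (d \in z).
Hypothesis tK : involutive t.
Hypothesis t_node : forall d, t d \in porbit (node M) d.
Hypothesis t_z : forall d, (t d != d) = (d \in z).
Hypothesis z_two : forall d d', d \in z -> d' \in z -> d' \in porbit (node M) d ->
  d' = d \/ d' = t d.
Hypothesis cz : c \in z.
Hypothesis z_cover : z = porbit s c :|: porbit s (edge M c).
Hypothesis z_sides : edge M c \notin porbit s c.
Hypothesis z_min : forall K : {set M}, (forall d, (face M d \in K) = (d \in K)) ->
  (forall d, d \notin z -> (edge M d \in K) = (d \in K)) ->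
  forall d, (edge M d \in K) = (d \in K).

Let Z : finType := {d : M | d \in z}.
Let D : finType := (M + Z)%type.

Let tz d : (t d \in z) = (d \in z).
Proof. by rewrite -!t_z tK eq_sym. Qed.

Let t_id d : d \notin z -> t d = d.
Proof. by rewrite -t_z negbK => /eqP. Qed.

Let mk d (dz : d \in z) : Z := exist _ d dz.
Let put d : option Z := insub d.
Let putT d (dz : d \in z) : put d = Some (mk dz). Proof. exact: insubT. Qed.
Let putN d : d \notin z -> put d = None. Proof. by move=> dz; apply: insubF; apply: negbTE. Qed.

(** An edge of [z] with darts [d] and [edge M d] becomes two edges, [inl d] with [inr (edge M d)]
    and [inl (edge M d)] with [inr d]. Each has an old face on the side of its [inl] dart and a new
    face on the other. *)
Definition cut_edge_fun (x : D) : D :=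
  match x with
  | inl d => if put (edge M d) is Some w then inr w else inl (edge M d)
  | inr w => inl (edge M (val w))
  end.

(** For [d] in [z], the rotation passes from [inl d] to [inr (t d)] and goes on from [node M (t d)].
    This splits the vertex into the two sectors between [d] and [t d]. *)
Definition cut_node_fun (x : D) : D :=
  match x with
  | inl d => if put (t d) is Some w then inr w else inl (node M d)
  | inr w => inl (node M (val w))
  end.

Lemma cut_edge_funK : involutive cut_edge_fun.
Proof.
case=> [d|[d dz]] /=; last by rewrite /= edgeK putT.
have [dz|dz] := boolP (edge M d \in z); first by rewrite putT /= edgeK.
by rewrite putN //= edgeK putN // -z_edge.
Qed.

Lemma cut_node_fun_inj : injective cut_node_fun.
Proof.
have inlE d : cut_node_fun (inl d) =
    if put (t d) is Some w then inr w else inl (node M d) by [].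
have neq d w : cut_node_fun (inl d) <> cut_node_fun (inr w).
  rewrite inlE; have [tdz|tdz] := boolP (t d \in z); first by rewrite putT.
  by rewrite putN // => -[/perm_inj dd]; rewrite tz dd (valP w) in tdz.
case=> [d|w] [d'|w']; [|by move/neq|by move/esym/neq|]; last first.
  by case=> /perm_inj/val_inj->.
rewrite !inlE; have [tdz|tdz] := boolP (t d \in z);
  have [tdz'|tdz'] := boolP (t d' \in z).
- by rewrite !putT => -[/perm_inj->].
- by rewrite putT putN.
- by rewrite putN // putT.
by rewrite !putN // => -[/perm_inj->].
Qed.

Definition cut_edge : {perm D} := perm (can_inj cut_edge_funK).
Definition cut_node : {perm D} := perm cut_node_fun_inj.

Let edgeI d : d \notin z -> cut_edge (inl d) = inl (edge M d).
Proof. by move=> dz; rewrite permE /= putN // z_edge. Qed.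
Let nodeI d : d \notin z -> cut_node (inl d) = inl (node M d).
Proof. by move=> dz; rewrite permE /= putN // tz. Qed.
Let cut_face := (cut_edge * cut_node)%g.

Let faceI d : cut_face (inl d) = inl (face M d).
Proof.
rewrite faceE permM !(permE (can_inj _), permE cut_node_fun_inj) /=.
have [dz|dz] := boolP (edge M d \in z); first by rewrite putT.
by rewrite putN //= putN ?tz.
Qed.

Let faceR w : exists2 w' : Z, val w' = s (val w) & cut_face (inr w) = inr w'.
Proof.
have ez : t (edge M (val w)) \in z by rewrite tz z_edge (valP w).
exists (mk ez); first by rewrite /= permM.
by rewrite permM !(permE (can_inj _), permE cut_node_fun_inj) /= putT.
Qed.

Lemma cut_edge_neq x : cut_edge x != x.
Proof.
rewrite permE; case: x => [d|w] //=.
have [dz|dz] := boolP (edge M d \in z); first by rewrite putT.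
by rewrite putN //; apply: contra (edge_neq d) => /eqP[->].
Qed.

(** The old darts in a closed set form a union of faces whose boundary lies in [z]. By [z_min] that
    boundary is empty, and the connectivity of [M] applies. *)
Lemma cut_connected : [transitive <<[set cut_node; cut_edge]>>%g, on [set: D] | 'P]%act.
Proof.
apply/connected_closed; split=> [|K' Kn Ke]; first by exists (inl c).
pose K := [set d | inl d \in K'].
have Kf d : (face M d \in K) = (d \in K).
  by rewrite !inE -faceI permM Kn Ke.
have Kz d : d \notin z -> (edge M d \in K) = (d \in K).
  by move=> dz; rewrite !inE -edgeI // Ke.
have KE := z_min Kf Kz.
have KN d : (node M d \in K) = (d \in K) by rewrite nodeE Kf KE.
have /connected_closed[_ /(_ K KN KE)[K0|K0]] := map_connected M.
  left; have inlK d : (inl d \in K') = false by have := in_set0 d; rewrite -K0 inE.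
  apply/setP => -[d|w]; rewrite in_set0 ?inlK //.
  by rewrite -Ke permE /= inlK.
right; have inlK d : inl d \in K' by have := in_setT d; rewrite -K0 inE.
apply/setP => -[d|w]; rewrite in_setT ?inlK //.
by rewrite -Ke permE /= inlK.
Qed.

Let cut_edgeK : involutive cut_edge.
Proof. by move=> x; rewrite !permE cut_edge_funK. Qed.

Definition cut_map : surface_map :=
  @SurfaceMap D cut_node cut_edge cut_edgeK cut_edge_neq cut_connected.

(** Without the copies, the new rotation is [t * node M], which splits each vertex of [z] in two;
    the copies are then inserted into its cycles. A vertex of [z] carries two darts of [z], hence
    the doubling. *)
Lemma card_nodes_cut : #|nodes cut_map|.*2 = #|nodes M|.*2 + #|z|.
Proof.
rewrite /nodes /= (@card_porbits_insert _ _ inl (t * node M)%g) //.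
- rewrite card_porbits_split //.
    by congr (_ + _); apply: eq_card => d; rewrite inE t_z.
  by move=> x y; rewrite !t_z => xz yz; apply: z_two.
- by move=> x y [].
- case=> [d|w]; first by exists d; left.
  by exists (node M (val w)); right; rewrite permE.
move=> d; have [dz|dz] := boolP (d \in z); last first.
  by left; rewrite nodeI // permM t_id.
right; rewrite !permM !permE /= putT ?tz // => tdz; split=> //.
by apply/codomP => -[].
Qed.

Let inr_orbit w x : x \in porbit cut_face (inr w) ->
  exists2 w' : Z, x = inr w' & val w' \in porbit s (val w).
Proof.
pose K (x : D) := if x is inr w' then val w' \in porbit s (val w) else false.
move/(@porbit_closed _ cut_face K) => Kx; suff: K x.
  by case: x {Kx} => // w' w'K; exists w'.
rewrite Kx /= ?porbit_id // => -[d|w']; rewrite /K ?faceI //.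
have [w2 w2E ->] := faceR w'; rewrite w2E -!eq_porbit_mem.
by rewrite (eq_porbits (porbit_step s _)).
Qed.

Let inr_porbit w w' : val w' \in porbit s (val w) ->
  (inr w' : D) \in porbit cut_face (inr w).
Proof.
case/porbitP=> n; elim: n w' => [|n IHn] w'.
  by rewrite expg0 perm1 => /val_inj->; rewrite porbit_id.
have snz : (s ^+ n)%g (val w) \in z.
  elim: n {IHn} => [|n IHn]; first by rewrite expg0 perm1 (valP w).
  by rewrite expgSr !permM tz z_edge.
have := IHn (mk snz) (erefl _) => IH; rewrite expgSr permM => w'E.
rewrite -(eq_porbits IH); have [w2 w2E w2f] := faceR (mk snz).
rewrite (_ : w' = w2); first by rewrite -w2f porbit_step.
by apply: val_inj; rewrite w'E w2E.
Qed.

(** Old faces survive on the [inl] side, and on the copies the face permutation is [s], with the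
    orbits of [c] and [edge M c], one for each side of [z]. *)
Lemma card_faces_cut : #|faces cut_map| = #|faces M| + 2.
Proof.
have ecz : edge M c \in z by rewrite z_edge.
pose w1 : Z := mk cz; pose w2 : Z := mk ecz.
rewrite /faces /= -/cut_face -[(edge M * _)%g]/(face M).
have -> : porbits cut_face = (fun O : {set M} => (inl : M -> D) @: O) @: porbits (face M)
    :|: [set porbit cut_face (inr w1); porbit cut_face (inr w2)].
  apply/setP => O; rewrite !inE; apply/imsetP/idP => [[[d|w] _ ->]|].
  - rewrite (@porbit_map _ _ inl (face M)) ?imset_f // => y _; exact: faceI.
  - have : (val w \in porbit s c) || (val w \in porbit s (edge M c)).
      by rewrite -in_setU -z_cover (valP w).
    by case/orP=> wO; apply/orP; right; rewrite (@eq_porbits _ _ (inr w1) _ (inr_porbit (w := w1) wO)) ?eqxx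
      || rewrite (@eq_porbits _ _ (inr w2) _ (inr_porbit (w := w2) wO)) eqxx ?orbT.
  case/or3P=> [/imsetP[_ /imsetP[d _ ->] ->]|/eqP->|/eqP->]; last 2 first.
  - by exists (inr w1).
  - by exists (inr w2).
  by exists (inl d) => //; rewrite (@porbit_map _ _ inl (face M)) // => y _; apply: faceI.
have inl_inj : injective (inl : M -> D) by move=> x y [].
rewrite cardsU card_imset; last exact: imset_inj.
rewrite cards2 (_ : porbit _ _ != _); last first.
  rewrite eq_porbit_mem porbit_sym; apply/negP => /inr_orbit[w' [<-]] /=.
  by rewrite (negbTE z_sides).
rewrite (_ : _ :&: _ = set0) ?cards0 ?subn0 //; apply/setP => O; rewrite in_set0 inE.
apply/negP => /andP[/imsetP[_ /imsetP[d _ ->] ->]].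
have nO w : (inl @: porbit (face M) d == porbit cut_face (inr w)) = false.
  apply/negP => /eqP/setP/(_ (inr w)); rewrite porbit_id => /imsetP[//].
by rewrite !inE !nO.
Qed.

(** Vertices and edges both increase by half of [#|z|], so that in Euler's formula the two new faces
    lower the genus by one. *)
Lemma cut_genus g : has_surface_genus M g.+1 -> has_surface_genus cut_map g.
Proof.
rewrite /has_surface_genus card_faces_cut.
have := card_nodes_cut.
have : #|edges M|.*2 = #|M| by apply: card_porbits_involution; [apply: edgeK|apply: edge_neq].
have : #|edges cut_map|.*2 = #|cut_map|.
  by apply: card_porbits_involution; [apply: edgeK|apply: edge_neq].
have -> : #|cut_map| = #|M| + #|z| by rewrite card_sum card_sig.
lia.
Qed.

(** The clause on [node] serves a drawing on [M] itself, the one on [face] a drawing on the dual of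
    [M]. *)
Lemma surgery g : has_surface_genus M g.+1 ->
  exists M' : surface_map, exists i : M -> M',
  [/\ has_surface_genus M' g, injective i,
      forall d, d \notin z -> edge M' (i d) = i (edge M d),
      forall d, d \notin z -> node M' (i d) = i (node M d)
    & forall d, face M' (i d) = i (face M d)].
Proof.
move=> Mg; exists cut_map, inl; split; [exact: cut_genus|by move=> x y []|..] => //.
Qed.

End Surgery.

(** * Homology modulo 2 *)

Section LinearAlgebra.
Local Open Scope ring_scope.
Import GRing.Theory.

(** The rank condition says that the homology [kermx N] modulo [P] is nonzero. If every cycle
    supported in [Y] lies in [P], then [P] and the vectors supported in [Y] together do not span
    [kermx N], and some functional [v] kills them but not [kermx N]. *)
Lemma kernel_alternative (F : fieldType) m n p (N : 'M[F]_(m, n)) (P : 'M[F]_(p, m))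
    (Y : pred 'I_m) :
    P *m N = 0 -> (\rank N + \rank P < m)%N ->
  (exists x : 'rV_m, [/\ x *m N = 0, forall i, x 0 i != 0 -> Y i & ~~ (x <= P)%MS]) \/
  (exists v : 'cV_m, [/\ P *m v = 0, forall i, v i 0 != 0 -> ~~ Y i
     & exists2 u : 'rV_m, u *m N = 0 & u *m v != 0]).
Proof.
move=> PN rk; pose K : 'M[F]_m := diag_mx (\row_i (Y i)%:R).
have [KZ|/row_subPn[i xP]] := boolP (K :&: kermx N <= P)%MS; last first.
  left; exists (row i (K :&: kermx N)%MS).
  move: xP; have := row_sub i (K :&: kermx N)%MS; rewrite sub_capmx => /andP[/submxP[y ->] /sub_kermxP->] xP.
  split=> // j; rewrite /K mul_mx_diag !mxE; case: (Y j) => //; by rewrite mulr0 eqxx.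
right; pose W := (P + K)%MS.
have PZ : (P <= kermx N)%MS by apply/sub_kermxP.
have ZW : ~~ (kermx N <= W)%MS.
  apply/negP => ZW; suff /mxrankS : (kermx N <= P)%MS.
    by rewrite mxrank_ker leq_subLR addnC leqNgt addnC rk.
  (* By the modular law, [W] meets [kermx N] in [P + (K :&: kermx N)], which is [P]; this is too
     small for the rank of [kermx N]. *)
  have : (kermx N <= W :&: kermx N)%MS by rewrite sub_capmx ZW submx_refl.
  rewrite -(matrix_modl K PZ) => /submx_trans; apply.
  by rewrite addsmx_sub submx_refl KZ.
have /row_subPn[i uW] := ZW; move: uW; rewrite submxE => /matrix0Pn[r [j]].
rewrite (ord1 r) => uv.
have Wv : W *m col j (cokermx W) = 0 by rewrite colE mulmxA mulmx_coker mul0mx.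
exists (col j (cokermx W)); split.
- by have /submxP[Q ->] : (P <= W)%MS := addsmxSl _ _; rewrite -mulmxA Wv mulmx0.
- move=> l; apply: contraNN => Yl; apply/eqP.
  have /submxP[Q KQ] : (K <= W)%MS := addsmxSr _ _.
  have : (K *m col j (cokermx W)) l 0 = 0 by rewrite KQ -mulmxA Wv mulmx0 mxE.
  by rewrite mul_diag_mx !mxE Yl mul1r.
exists (row i (kermx N)); first by rewrite -row_mul mulmx_ker row0.
apply/eqP => /matrixP/(_ 0 0); rewrite colE mulmxA -colE [LHS]mxE [RHS]mxE => e.
by rewrite e eqxx in uv.
Qed.

Lemma b2f_add : {morph (fun b : bool => b%:R : 'F_2) : a b / a (+) b >-> a + b}.
Proof. by case=> -[]; apply: val_inj. Qed.

Lemma b2f_sum I (r : seq I) (P B : pred I) :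
  (\big[addb/false]_(i <- r | P i) B i)%:R = \sum_(i <- r | P i) (B i)%:R :> 'F_2.
Proof. exact: (big_morph _ b2f_add). Qed.

Lemma f2bK (x : 'F_2) : (x != 0)%:R = x.
Proof. by apply: val_inj; case: x => [[|[|[]]]]. Qed.

Lemma addF2 (x : 'F_2) : x + x = 0.
Proof. by apply: val_inj; case: x => [[|[|[]]]]. Qed.

End LinearAlgebra.

(** Numbers the cycles of [p] so that they can index matrices; [r] picks a representative of
    each. *)
Lemma orbit_index (T : finType) (p : {perm T}) :
  exists q : T -> 'I_#|porbits p|, exists2 r, cancel r q &
    forall d d', (q d == q d') = (d \in porbit p d').
Proof.
have O d : porbit p d \in porbits p by apply: imset_f.
pose q d := enum_rank_in (O d) (porbit p d).
have ex (j : 'I_#|porbits p|) : exists d, porbit p d == enum_val j.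
  have : enum_val j \in porbits p by apply: enum_valP.
  by move=> /imsetP [d _ ->]; exists d.
exists q, (fun j => xchoose (ex j)).
  move=> j; apply: enum_val_inj; rewrite enum_rankK_in ?O //.
  exact/eqP/(xchooseP (ex j)).
move=> d d'; rewrite -eq_porbit_mem; apply/eqP/eqP => [/(congr1 enum_val)|e].
  by rewrite !enum_rankK_in.
by apply: enum_val_inj; rewrite !enum_rankK_in.
Qed.

(** Chains of edges modulo 2 are encoded as sets of darts that contain both darts of an edge or
    neither. *)
Definition edge_closed (M : surface_map) (z : {set M}) :=
  forall d, (edge M d \in z) = (d \in z).

(** For [p = node M] these are the closed chains of [M], for [p = face M] those of its dual. A loop
    counts twice at its vertex. *)
Definition even_on (M : surface_map) (p : {perm M}) (z : {set M}) :=
  [forall d, ~~ \big[addb/false]_(d' in porbit p d) (d' \in z)].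

Definition cut_set (M : surface_map) (X : {set M}) : {set M} :=
  [set d | (d \in X) (+) (edge M d \in X)].

(* [z] bounds for [p = face M], and is a vertex cut for [p = node M]. *)
Definition is_cut (M : surface_map) (p : {perm M}) (z : {set M}) :=
  [exists X : {set M}, [forall d, (p d \in X) == (d \in X)] && (z == cut_set X)].

Section Homology.
Variables (M : surface_map) (g : nat) (Y : {set M}).
Hypothesis Mg : has_surface_genus M g.+1.
Hypothesis Yedge : edge_closed Y.
Local Open Scope ring_scope.
Import GRing.Theory.

(** [kernel_alternative] is applied over the field of two elements to the boundary matrices [N],
    from edges to vertices, and [P], from faces to edges. Their ranks are below the numbers of
    vertices and of faces, so for positive genus Euler's formula leaves their sum below the number
    of edges. *)
Lemma cycle_or_cocycle :
  (exists z, [/\ edge_closed z, z \subset Y, even_on (node M) z & ~~ is_cut (face M) z]) \/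
  (exists z, [/\ edge_closed z, [disjoint z & Y], even_on (face M) z
               & ~~ is_cut (node M) z]).
Proof.
have [ei [re re_ei ei_eq]] := orbit_index (edge M).
have [nq [rn rn_nq nq_eq]] := orbit_index (node M).
have [fq [rf rf_fq fq_eq]] := orbit_index (face M).
pose F2 : fieldType := 'F_2.
(* Summing over both darts of an edge makes a loop, or an edge with one face on both sides,
   contribute zero modulo 2. *)
pose inc n (q : M -> 'I_n) : 'M[F2]_(_, n) :=
  \matrix_(i, j) \sum_(d | ei d == i) (q d == j)%:R.
have ei_edge d : ei (edge M d) = ei d by apply/eqP; rewrite ei_eq porbit_step.
have sum_edge d (f : M -> F2) : \sum_(d' | ei d' == ei d) f d' = f d + f (edge M d).
  rewrite (bigD1 d) ?eqxx //= (bigD1 (edge M d)) /=; last by rewrite ei_edge eqxx edge_neq.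
  rewrite big1 ?addr0 // => d' /andP[/andP[+ nd] ned].
  rewrite ei_eq porbit_involution; last exact: edgeK.
  by rewrite !inE (negbTE nd) (negbTE ned).
have incL n (q : M -> 'I_n) (x : 'rV[F2]_#|porbits (edge M)|) j :
    (x *m inc n q) 0 j = \sum_(d | q d == j) x 0 (ei d).
  rewrite mxE (partition_big ei xpredT) //=; apply: eq_bigr => i _.
  rewrite mxE big_distrr /= [LHS]big_mkcond [RHS]big_mkcond; apply: eq_bigr => d _.
  case: (eqVneq (ei d) i) => [<-|_]; rewrite ?andbT ?andbF //.
  by case: (q d == j); rewrite ?mulr1 ?mulr0.
have incR n (q : M -> 'I_n) k (y : 'M[F2]_(n, k)) d l :
    (inc n q *m y) (ei d) l = y (q d) l + y (q (edge M d)) l.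
  rewrite -(sum_edge d (fun d' => y (q d') l)) mxE; under eq_bigr do rewrite mxE big_distrl /=.
  rewrite exchange_big /=; apply: eq_bigr => d' _.
  rewrite (bigD1 (q d')) //= eqxx mul1r big1 ?addr0 // => i /negbTE.
  by rewrite eq_sym => ->; rewrite mul0r.
(* The two darts of an edge contribute equally to the constant vector, which is therefore in the
   kernel. *)
have rk n (q : M -> 'I_n) : (0 < n)%N -> (\rank (inc n q) < n)%N.
  move=> n_gt0; pose u : 'cV[F2]_n := const_mx 1.
  have Nu : inc n q *m u = 0.
    by apply/matrixP => i j; rewrite -(re_ei i) incR !mxE addF2.
  have := mulmx0_rank_max Nu; apply: leq_trans; rewrite -addn1 leq_add2l lt0n mxrank_eq0.
  by apply/matrix0Pn; exists (Ordinal n_gt0), 0; rewrite mxE oner_eq0.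
pose N := inc _ nq; pose P := (inc _ fq)^T.
have PN : P *m N = 0.
  apply/matrixP => i j; have -> : (P *m N) i j = (row i P *m N) 0 j by rewrite -row_mul [RHS]mxE.
  rewrite incL mxE.
  (* The faces on the two sides of an edge are those of [d] and of [node M d]. As [node M] permutes
     the darts at a vertex, the two resulting sums cancel. *)
  have rowP d : row i P 0 (ei d) = (fq d == i)%:R + (fq (node M d) == i)%:R.
    rewrite !mxE sum_edge; congr (_ + (_ == i)%:R).
    by apply/eqP; rewrite eq_sym fq_eq nodeE porbit_step.
  under eq_bigr do rewrite rowP.
  rewrite big_split /= [X in _ + X](_ : _ = \sum_(d | nq d == j) (fq d == i)%:R) ?addF2 //.
  rewrite [RHS](reindex_inj (perm_inj (s := node M))) /=; apply: eq_bigl => d.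
  by rewrite (_ : nq (node M d) = nq d) //; apply/eqP; rewrite nq_eq porbit_step.
have orb_gt0 (p : {perm M}) : (0 < #|porbits p|)%N.
  have [[d _] _] := connected_closed _ _ (map_connected M).
  by apply/card_gt0P; exists (porbit p d); apply: imset_f.
have rkPN : (\rank N + \rank P < #|porbits (edge M)|)%N.
  have rkN : (\rank N < #|nodes M|)%N := rk _ nq (orb_gt0 _).
  have rkP : (\rank P < #|faces M|)%N by rewrite mxrank_tr; exact: (rk _ fq (orb_gt0 _)).
  change (\rank N + \rank P < #|edges M|)%N; move: Mg; rewrite /has_surface_genus.
  lia.
have chain_sum (x : 'I_#|porbits (edge M)| -> F2) n (q : M -> 'I_n) p d :
    (forall d d', (q d == q d') = (d \in porbit p d')) ->
    \sum_(d' | q d' == q d) x (ei d') =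
    (\big[addb/false]_(d' in porbit p d) (d' \in [set d | x (ei d) != 0]))%:R.
  move=> q_eq; rewrite b2f_sum; apply: eq_big => d'; first by rewrite q_eq.
  by rewrite inE f2bK.
have chain_edge (x : 'I_#|porbits (edge M)| -> F2) : edge_closed [set d | x (ei d) != 0].
  by move=> d; rewrite !inE ei_edge.
have cutE n (q : M -> 'I_n) r p (x : 'I_#|porbits (edge M)| -> F2) :
    cancel r q -> (forall d d', (q d == q d') = (d \in porbit p d')) ->
    is_cut p [set d | x (ei d) != 0] ->
  exists y : 'cV[F2]_n, forall i, x i = (inc n q *m y) i 0.
  move=> rK q_eq /existsP[X /andP[/forallP Xp /eqP/setP xX]].
  exists (\col_j (r j \in X)%:R) => i; rewrite -(re_ei i) incR !mxE -b2f_add.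
  have rX d : (r (q d) \in X) = (d \in X).
    apply: (@porbit_closed _ p [in X]) => [d'|]; first exact/eqP/Xp.
    by rewrite -q_eq rK eqxx.
  by have := xX (re i); rewrite !inE !rX => <-; rewrite f2bK.
have [[x [xN xY xP]]|[v [Pv vY [u uN uv]]]] :=
    kernel_alternative (fun i => re i \in Y) PN rkPN; [left|right].
  have Yre d : (re (ei d) \in Y) = (d \in Y).
    apply: (@porbit_closed _ (edge M) [in Y]) => [d'|]; first exact: Yedge.
    by rewrite -ei_eq re_ei eqxx.
  exists [set d | x 0 (ei d) != 0]; split=> //.
  - by apply/subsetP => d; rewrite inE => /xY; rewrite Yre.
  - apply/forallP => d; apply/negP => odd_d.
    have := incL _ nq x (nq d); rewrite xN mxE (chain_sum (x 0) _ _ _ _ nq_eq) odd_d.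
    by move/eqP; rewrite eq_sym oner_eq0.
  apply: contra xP => /(cutE _ _ _ _ _ rf_fq fq_eq)[y xy].
  apply/submxP; exists y^T; apply: trmx_inj; rewrite trmx_mul !trmxK.
  by apply/matrixP => i j; rewrite (ord1 j) mxE xy.
have Yre d : (re (ei d) \in Y) = (d \in Y).
  apply: (@porbit_closed _ (edge M) [in Y]) => [d'|]; first exact: Yedge.
  by rewrite -ei_eq re_ei eqxx.
exists [set d | v (ei d) 0 != 0]; split=> //.
- exact: (chain_edge (v^~ 0)).
- rewrite disjoint_subset; apply/subsetP => d; rewrite inE => /vY.
  by rewrite Yre.
- apply/forallP => d; apply/negP => odd_d.
  have := incL _ fq v^T (fq d); under eq_bigr do rewrite mxE.
  rewrite (chain_sum (v^~ 0) _ _ _ _ fq_eq) odd_d.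
  rewrite -[inc _ fq]trmxK -trmx_mul -/P Pv !mxE.
  by move/eqP; rewrite eq_sym oner_eq0.
(* A vertex cut has the form [N *m y], and pairs to zero with the closed chain [u]. *)
apply: contra uv => /(cutE _ _ _ (node M) (v^~ 0) rn_nq nq_eq)[y vy].
have -> : v = N *m y by apply/matrixP => i j; rewrite (ord1 j) vy.
by rewrite mulmxA uN mul0mx.
Qed.
End Homology.

(** * Smallest nonbounding cycles *)

Definition parity (T : finType) (O z : {set T}) := \big[addb/false]_(d in O) (d \in z).

Definition symdiff (T : finType) (a b : {set T}) := [set d | (d \in a) (+) (d \in b)].

Lemma in_symdiff (T : finType) (a b : {set T}) d :
  (d \in symdiff a b) = (d \in a) (+) (d \in b).
Proof. exact: in_set. Qed.

Lemma parity_symdiff (T : finType) (O a b : {set T}) :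
  parity O (symdiff a b) = parity O a (+) parity O b.
Proof. by rewrite -big_split; apply: eq_bigr => d _; rewrite inE. Qed.

Lemma parity_card (T : finType) (O z : {set T}) : parity O z = odd #|O :&: z|.
Proof.
rewrite -sum1_card (big_morph odd oddD (erefl _)) /parity [LHS]big_mkcond [RHS]big_mkcond /=.
by apply: eq_bigr => d _; rewrite inE; case: (d \in O); case: (d \in z).
Qed.

Lemma parity1 (T : finType) (O : {set T}) d : parity O [set d] = (d \in O).
Proof.
rewrite parity_card; case: (boolP (d \in O)) => dO.
  by rewrite (setIidPr _) ?sub1set // cards1.
by rewrite (disjoint_setI0 _) ?cards0 // disjoint_sym disjoints1.
Qed.

Lemma card_symdiff (T : finType) (a b : {set T}) : #|symdiff a b| <= #|a| + #|b|.
Proof.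
apply: leq_trans (leq_card_setU _ _); apply/subset_leq_card/subsetP => d.
by rewrite !inE; case: (d \in a).
Qed.

Lemma symdiff_addKl (T : finType) (a b : {set T}) : symdiff a (symdiff a b) = b.
Proof. by apply/setP => d; rewrite !inE addKb. Qed.

Lemma symdiffC (T : finType) (a b : {set T}) : symdiff a b = symdiff b a.
Proof. by apply/setP => d; rewrite !inE addbC. Qed.

Lemma edge_closed_symdiff (M : surface_map) (a b : {set M}) :
  edge_closed a -> edge_closed b -> edge_closed (symdiff a b).
Proof. by move=> ae be d; rewrite !inE ae be. Qed.

Lemma even_on_symdiff (M : surface_map) (p : {perm M}) (a b : {set M}) :
  even_on p a -> even_on p b -> even_on p (symdiff a b).
Proof.
move=> /forallP ae /forallP be; apply/forallP => d.
by have := parity_symdiff (porbit p d) a b; rewrite /parity => ->;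
  rewrite (negbTE (ae d)) (negbTE (be d)).
Qed.

Lemma is_cut_symdiff (M : surface_map) (p : {perm M}) (a b : {set M}) :
  is_cut p a -> is_cut p b -> is_cut p (symdiff a b).
Proof.
move=> /existsP[X /andP[/forallP Xp /eqP->]] /existsP[X' /andP[/forallP Xp' /eqP->]].
apply/existsP; exists (symdiff X X'); apply/andP; split.
  by apply/forallP => d; rewrite !inE (eqP (Xp d)) (eqP (Xp' d)).
by apply/eqP/setP => d; rewrite !inE addbACA.
Qed.

(** The elements of [z] on each cycle are listed, and the positions [2 i] and [2 i + 1] are
    exchanged; evenness ensures that no element is left over. *)
Lemma even_pairing (T : finType) (p : {perm T}) (z : {set T}) :
    (forall d, ~~ parity (porbit p d) z) ->
  exists t : {perm T}, [/\ involutive t, forall d, t d \in porbit p d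
    & forall d, (t d != d) = (d \in z)].
Proof.
move=> ev; pose sq d := enum (porbit p d :&: z).
pose sw i := if odd i then i.-1 else i.+1.
have swK : involutive sw.
  by case=> [|i] //; rewrite /sw /=; case io: (odd i); rewrite /= io.
have sw_neq i : sw i != i.
  by case: i => [|i] //; rewrite /sw /=; case: (odd i) => /=; lia.
have sw_size d i : i < size (sq d) -> sw i < size (sq d).
  have := ev d; rewrite parity_card -cardE /sw; case io: (odd i) => ev_d le_i.
    by apply: leq_ltn_trans le_i; apply: leq_pred.
  by rewrite ltn_neqAle le_i andbT; apply: contraNneq ev_d => <-; rewrite /= io.
pose t d := if d \in z then nth d (sq d) (sw (index d (sq d))) else d.
have d_sq d : d \in z -> index d (sq d) < size (sq d).
  by move=> dz; rewrite index_mem mem_enum inE porbit_id.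
have t_sq d : d \in z -> t d \in sq d.
  by move=> dz; rewrite /t dz mem_nth ?sw_size ?d_sq.
have tP d : t d \in porbit p d.
  have [dz|dz] := boolP (d \in z); last by rewrite /t (negbTE dz) porbit_id.
  by have := t_sq _ dz; rewrite mem_enum inE => /andP[].
have sq_t d : sq (t d) = sq d by rewrite /sq (eq_porbits (tP d)).
have t_z d : (t d \in z) = (d \in z).
  have [dz|dz] := boolP (d \in z); last by rewrite /t !(negbTE dz).
  by have := t_sq _ dz; rewrite mem_enum inE => /andP[].
have tK : involutive t.
  move=> d; have [dz|dz] := boolP (d \in z); last by rewrite /t !(negbTE dz).
  rewrite {1}/t t_z dz sq_t {2}/t dz index_uniq ?enum_uniq ?sw_size ?d_sq //.
  by rewrite swK (set_nth_default d) ?d_sq // nth_index // -index_mem d_sq.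
exists (perm (can_inj tK)); split=> [d|d|d]; rewrite !permE //.
rewrite /t; case: ifP => dz; last by rewrite eqxx.
have e : nth d (sq d) (index d (sq d)) = d by rewrite nth_index // -index_mem d_sq.
by rewrite -[X in _ != X]e nth_uniq ?enum_uniq ?sw_size ?d_sq ?sw_neq.
Qed.

(** The darts [edge M d] and [node M d] lie on one face, so [d] is in the cut exactly when
    membership in [K] changes from [d] to [node M d]. Around a vertex it changes an even number of
    times. *)
Lemma even_cut_set (M : surface_map) (K : {set M}) :
  (forall d, (face M d \in K) = (d \in K)) -> even_on (node M) (cut_set K).
Proof.
move=> Kf; apply/forallP => d0.
have KE d : (d \in cut_set K) = (d \in K) (+) (node M d \in K).
  by rewrite inE nodeE Kf.
under eq_bigr do rewrite KE.
rewrite big_split /= [X in _ (+) X](_ : _ = \big[addb/false]_(d in porbit (node M) d0) (d \in K)).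
  by rewrite addbb.
rewrite [RHS](reindex_inj (perm_inj (s := node M))) /=; apply: eq_bigl => d.
by rewrite -!eq_porbit_mem (eq_porbits (porbit_step _ d)).
Qed.

Section MinimalCycle.
Variables (M : surface_map) (z : {set M}).
Hypothesis z_edge : edge_closed z.
Hypothesis z_even : even_on (node M) z.
Hypothesis z_min : forall w : {set M}, w \subset z -> edge_closed w -> even_on (node M) w ->
  w = set0 \/ w = z.
Hypothesis z_noncut : ~~ is_cut (face M) z.

Section Pairing.
Variable t : {perm M}.
Hypothesis tK : involutive t.
Hypothesis t_node : forall d, t d \in porbit (node M) d.
Hypothesis t_z : forall d, (t d != d) = (d \in z).
Let s : {perm M} := (edge M * t)%g.

Let sE d : s d = t (edge M d). Proof. exact: permM. Qed.

Let tz d : (t d \in z) = (d \in z).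
Proof. by rewrite -!t_z tK eq_sym. Qed.

Let sz d : (s d \in z) = (d \in z).
Proof. by rewrite sE tz z_edge. Qed.

Let iter_sz k d : (iter k s d \in z) = (d \in z).
Proof. by elim: k => //= k; rewrite sz. Qed.

(* [s] is a product of two involutions without fixed points on [z], so that in
   the dihedral group they generate no reflection has a fixed point. *)
Let no_flip k c : c \in z -> edge M c != iter k s c.
Proof.
have [n] := ubnP k; elim: n k c => // n IHn [|[|k]] c lek cz /=.
- exact: edge_neq.
- by rewrite sE eq_sym t_z z_edge.
have scz : s c \in z by rewrite sz.
apply/eqP => e; have /eqP[] : edge M (s c) != iter k s (s c) by apply: IHn; [lia|].
by rewrite -iterSr [s c]sE e sE tK edgeK.
Qed.

Let no_flip2 i j c : c \in z -> edge M (iter j s c) != iter i s c.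
Proof.
move=> cz; have [le_ji|/ltnW le_ij] := leqP j i.
  by rewrite -(subnK le_ji) iterD no_flip ?iter_sz.
rewrite -(subnK le_ij) iterD; apply/eqP => /(congr1 (edge M)); rewrite edgeK => /esym/eqP.
by rewrite (negbTE (no_flip _ _)) // iter_sz.
Qed.

(** The first [k] edges of the walk from [c], as a chain modulo 2: [s] crosses an edge and leaves
    its far end by the paired dart. Symmetric differences are used because the edges are not yet
    known to be distinct. *)
Fixpoint cycle_arc (c : M) k : {set M} :=
  if k is k'.+1 then symdiff (symdiff [set c] [set edge M c]) (cycle_arc (s c) k') else set0.

Lemma arcD c k m : cycle_arc c (k + m) = symdiff (cycle_arc c k) (cycle_arc (iter k s c) m).
Proof.
elim: k c => [|k IHk] c; first by apply/setP => d; rewrite !inE.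
rewrite addSn iterSr /= IHk; apply/setP => d; rewrite !inE.
by rewrite !addbA.
Qed.

Lemma arc_edge c k : edge_closed (cycle_arc c k).
Proof.
elim: k c => [|k IHk] c; first by move=> d; rewrite !inE.
apply: edge_closed_symdiff; last exact: IHk.
move=> d; rewrite !in_symdiff !in_set1.
by rewrite (inj_eq perm_inj) (can2_eq (edgeK (s := M)) (edgeK (s := M))) [_ (+) (d == c)]addbC.
Qed.

Lemma arc_mem c k d : d \in cycle_arc c k ->
  exists2 j, j < k & d = iter j s c \/ d = edge M (iter j s c).
Proof.
elim: k c => [|k IHk] c; first by rewrite inE.
rewrite /= in_symdiff; case: (boolP (d \in cycle_arc (s c) k)).
  by move=> /IHk[j jk dj] _; exists j.+1; rewrite // iterSr.
move=> _; rewrite addbF in_symdiff !in_set1 => dc; exists 0 => //=.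
by move: dc; case: (d =P c) => [->|_ /= /eqP]; auto.
Qed.

(** The boundary of an arc consists of its two end vertices, since the contributions at inner
    vertices cancel. *)
Lemma parity_arc c k d : parity (porbit (node M) d) (cycle_arc c k) =
  (c \in porbit (node M) d) (+) (iter k s c \in porbit (node M) d).
Proof.
elim: k c => [|k IHk] c.
  by rewrite addbb parity_card setI0 cards0.
rewrite iterSr [cycle_arc _ _]/= !parity_symdiff IHk !parity1.
have -> : (s c \in porbit (node M) d) = (edge M c \in porbit (node M) d).
  by rewrite sE -!eq_porbit_mem (eq_porbits (t_node _)).
by rewrite addbA -[_ (+) _ (+) (edge M c \in _)]addbA addbb addbF.
Qed.

Lemma card_arc c k : #|cycle_arc c k| <= k.*2.
Proof.
elim: k c => [|k IHk] c; first by rewrite cards0.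
rewrite doubleS /=; apply: leq_trans (card_symdiff _ _) _.
apply: leq_trans (leq_add (card_symdiff _ _) (IHk _)) _.
by rewrite !cards1.
Qed.

Lemma arc_sub c k : c \in z -> cycle_arc c k \subset z.
Proof.
move=> cz; apply/subsetP => d /arc_mem[j _ [->|->]]; by rewrite ?z_edge iter_sz.
Qed.

Section Base.
Variable c : M.
Hypothesis cz : c \in z.
Let n := #|porbit s c|.

Let n_gt0 : 0 < n. Proof. by rewrite lt0n card_porbit_neq0. Qed.

Let iter_n : iter n s c = c. Proof. exact: iter_porbit. Qed.

Let iter_inj i j : i < n -> j < n -> iter i s c = iter j s c -> i = j.
Proof.
move=> ni nj; rewrite -(nth_traject s ni) -(nth_traject s nj) => /eqP.
by rewrite nth_uniq ?size_traject ?uniq_traject_porbit // => /eqP.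
Qed.

(** During one turn the forward darts are distinct, and by [no_flip2] none is the reverse of a
    forward dart. Hence nothing cancels in the symmetric differences. *)
Let arc_iter i k : k <= n -> i < n -> (iter i s c \in cycle_arc c k) = (i < k).
Proof.
move=> kn ni; have notin a m : a + m <= n -> (i < a) || (a + m <= i) ->
    (iter i s c \in cycle_arc (iter a s c) m) = false.
  move=> amn out; apply/negP => /arc_mem[j jm]; rewrite -iterD; case=> [/iter_inj|].
    by move/(_ ni); rewrite -ltnS => /(_ _) e; have := e; lia.
  by move/esym/eqP; rewrite (negbTE (no_flip2 _ _ cz)).
have [ik|ki] := ltnP i k; last by apply: (notin 0).
have e : k = i + (1 + (k - i.+1)) by lia.
have n1 : (iter i s c \in cycle_arc c i) = false by apply: (notin 0); lia.
have n2 : (iter i s c \in cycle_arc (s (iter i s c)) (k - i.+1)) = false.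
  by apply: (notin i.+1); lia.
rewrite e !arcD /= !in_symdiff !in_set1 in_set0 n1 n2 eqxx.
by rewrite [iter i s c == _]eq_sym (negbTE (no_flip2 i i cz)).
Qed.

(** A full turn is a nonempty closed chain inside [z], and minimality leaves only [z]. *)
Lemma arc_full : cycle_arc c n = z.
Proof.
have [|n0|//] := z_min (arc_sub n cz) (arc_edge c n).
  by apply/forallP => d; rewrite -/(parity _ _) parity_arc iter_n addbb.
by have := arc_iter (leqnn n) n_gt0; rewrite n_gt0 n0 inE.
Qed.

(** An early return to the vertex of [c] would close up an arc that is nonempty and misses a dart of
    [z], against minimality. So the cycle is simple. *)
Lemma arc_node k : 0 < k < n -> iter k s c \notin porbit (node M) c.
Proof.
move=> /andP[k0 kn]; apply/negP => ck.
have [|e|e] := z_min (arc_sub k cz) (arc_edge c k).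
- apply/forallP => d; rewrite -/(parity _ _) parity_arc.
  by rewrite -!eq_porbit_mem (eq_porbits ck) addbb.
- by have := arc_iter (ltnW kn) n_gt0; rewrite k0 e inE.
- by have := arc_iter (ltnW kn) kn; rewrite ltnn e iter_sz cz.
Qed.

Lemma arc_cover d : d \in z ->
  exists2 k, k < n & d \in porbit (node M) (iter k s c).
Proof.
rewrite -{1}arc_full => /arc_mem[j jn [->|->]]; first by exists j; rewrite ?porbit_id.
exists (if j.+1 == n then 0 else j.+1); first by case: eqP => [_|] //; lia.
have -> : iter (if j.+1 == n then 0 else j.+1) s c = s (iter j s c).
  by case: eqP => // e; rewrite -iterS e iter_n.
by rewrite porbit_sym sE t_node.
Qed.

Lemma card_cycle : #|z| = n.*2.
Proof.
apply/eqP; rewrite eqn_leq -{1}arc_full card_arc /=.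
have sub : porbit s c :|: edge M @: porbit s c \subset z.
  apply/subsetP => d; have oz x : x \in porbit s c -> x \in z.
    by case/porbitP=> i ->; rewrite permX iter_sz.
  by rewrite inE => /orP[/oz//|/imsetP[x /oz xz ->]]; rewrite z_edge.
apply: leq_trans (subset_leq_card sub); rewrite cardsU card_imset; last exact: perm_inj.
rewrite (_ : _ :&: _ = set0) ?cards0 ?subn0 -?addnn // -/n.
apply/setP => d; rewrite in_set0 inE; apply/negP => /andP[/porbitP[i ->] /imsetP[_ /porbitP[j ->]]].
by rewrite !permX => /esym/eqP; rewrite (negbTE (no_flip2 _ _ cz)).
Qed.

Lemma card_arc_compl k : k <= n -> #|symdiff z (cycle_arc c k)| <= (n - k).*2.
Proof.
move=> kn; rewrite -arc_full -{1}(subnKC kn) arcD.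
rewrite (_ : symdiff _ _ = cycle_arc (iter k s c) (n - k)) ?card_arc //.
by apply/setP => d; rewrite !inE addbC addKb.
Qed.

Lemma cycle_node_two d : d \in z -> d \in porbit (node M) c -> d = c \/ d = t c.
Proof.
rewrite -{1}arc_full => /arc_mem[j jn [->|->]] dc.
  left; case: j jn dc => // j jn dc.
  by have := @arc_node j.+1; rewrite jn dc => /(_ isT).
(* The reverse of step [j] is paired with the dart of step [j.+1] at the same vertex, so by
   [arc_node] that step completes the turn. *)
right; rewrite -[LHS]tK -sE -iterS; congr (t _).
have [jn'|] := ltnP j.+1 n; last by move=> ?; rewrite (_ : j.+1 = n) ?iter_n //; lia.
have := @arc_node j.+1; rewrite jn' => /(_ isT); rewrite iterS sE.
by rewrite -eq_porbit_mem (eq_porbits (t_node _)) eq_porbit_mem dc.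
Qed.

Lemma cycle_cover : z = porbit s c :|: porbit s (edge M c).
Proof.
(* Reversal turns [s] into its inverse, so the reversed darts form the orbit of [edge M c]. *)
have flip x : s (edge M (s x)) = edge M x by rewrite !sE edgeK tK.
apply/eqP; rewrite eqEsubset; apply/andP; split; apply/subsetP => d.
  rewrite -{1}arc_full => /arc_mem[j jn [->|->]]; rewrite inE.
    by rewrite -permX mem_porbit.
  apply/orP; right; elim: j {jn} => [|j]; first exact: porbit_id.
  rewrite -!eq_porbit_mem => /eqP<-; rewrite -(flip (iter j s c)).
  by rewrite (eq_porbits (porbit_step _ _)).
rewrite inE => /orP[] /porbitP[i ->]; by rewrite permX iter_sz ?z_edge.
Qed.

Lemma cycle_sides : edge M c \notin porbit s c.
Proof.
apply/negP => /porbitP[i]; rewrite permX => /eqP; by rewrite (negbTE (no_flip _ cz)).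
Qed.

End Base.

End Pairing.

Lemma cycle_pairing : exists t : {perm M}, [/\ involutive t,
  forall d, t d \in porbit (node M) d & forall d, (t d != d) = (d \in z)].
Proof. by apply: even_pairing => d; have := forallP z_even d. Qed.

Lemma cycle_neq0 : exists c, c \in z.
Proof.
apply/set0Pn; apply: contra z_noncut => /eqP->.
apply/existsP; exists set0; apply/andP; split; first by apply/forallP => d; rewrite !inE.
by apply/eqP/setP => d; rewrite !inE.
Qed.

Lemma cycle_surgery g : has_surface_genus M g.+1 ->
  exists M' : surface_map, exists i : M -> M',
  [/\ has_surface_genus M' g, injective i,
      forall d, d \notin z -> edge M' (i d) = i (edge M d),
      forall d, d \notin z -> node M' (i d) = i (node M d)
    & forall d, face M' (i d) = i (face M d)].
Proof.
have [t [tK t_node t_z]] := cycle_pairing; have [c cz] := cycle_neq0.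
apply: (@surgery M z t c) => //.
- by move=> d d' dz; apply: (cycle_node_two tK t_node t_z dz).
- exact: cycle_cover.
- exact: cycle_sides.
(* The boundary of [K] is a closed chain inside [z], hence empty or [z]; it cannot be [z], which
   does not bound. *)
move=> K Kf Kz d; have Ksub : cut_set K \subset z.
  by apply/subsetP => e; rewrite inE; apply: contraTT => /Kz->; rewrite addbb.
have [||K0|Kz'] := z_min Ksub; last 1 first.
- by case/existsP: z_noncut; exists K; rewrite Kz' eqxx andbT; apply/forallP => e; rewrite Kf.
- by move=> e; rewrite !inE edgeK addbC.
- exact: even_cut_set.
by have := in_set0 d; rewrite -K0 inE; case: (d \in K); case: (_ \in K).
Qed.

End MinimalCycle.

(** * Reducing the genus *)

(** A chain [z] of least size is also minimal for inclusion: a smaller closed chain [w] inside [z]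
    bounds, so [z :\: w] does not bound and has at least the size of [z], which makes [w] empty. *)
Lemma min_noncut (M : surface_map) (Y z0 : {set M}) :
    edge_closed z0 -> z0 \subset Y -> even_on (node M) z0 -> ~~ is_cut (face M) z0 ->
  exists z : {set M}, [/\ [/\ edge_closed z, z \subset Y, even_on (node M) z & ~~ is_cut (face M) z],
    forall w : {set M}, edge_closed w -> w \subset Y -> even_on (node M) w -> ~~ is_cut (face M) w ->
      #|z| <= #|w|
  & forall w : {set M}, w \subset z -> edge_closed w -> even_on (node M) w -> w = set0 \/ w = z].
Proof.
move=> ze0 zY0 zn0 zc0; pose P (w : {set M}) := [&& [forall d, (edge M d \in w) == (d \in w)],
  w \subset Y, even_on (node M) w & ~~ is_cut (face M) w].
have PP w : reflect [/\ edge_closed w, w \subset Y, even_on (node M) w & ~~ is_cut (face M) w] (P w).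
  apply: (iffP and4P) => -[we wY wn wc]; split=> //.
    by move=> d; apply/eqP; have := forallP we d.
  by apply/forallP => d; rewrite we.
have P0 : P z0 by apply/PP.
case: (arg_minnP (fun w : {set M} => #|w|) P0) => z /PP[ze zY zn zc] zmin.
have {}zmin (w : {set M}) : edge_closed w -> w \subset Y -> even_on (node M) w -> ~~ is_cut (face M) w ->
    #|z| <= #|w| by move=> *; apply: zmin; apply/PP.
exists z; split=> // w wz we wn.
have wY := subset_trans wz zY.
have dE : symdiff z w = z :\: w.
  by apply/setP => d; rewrite !inE; have := subsetP wz d; case: (d \in w) => [->|_] //; rewrite addbF.
have [wc|wc] := boolP (is_cut (face M) w); last first.
  by right; apply/eqP; rewrite eqEcard wz zmin.
left; have : #|z| <= #|symdiff z w|.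
  apply: zmin; [exact: edge_closed_symdiff| |exact: even_on_symdiff|].
    by rewrite dE (subset_trans _ zY) // subsetDl.
  apply: contra zc => dc; rewrite -(symdiff_addKl w z).
  by apply: is_cut_symdiff => //; rewrite symdiffC.
rewrite dE -(cardsID w z) (setIidPr wz) -[X in _ <= X]add0n leq_add2r leqn0 cards_eq0.
by move/eqP.
Qed.

(** * The dual map *)

Lemma dual_connected (M : surface_map) :
  [transitive <<[set face M; edge M]>>%g, on [set: M] | 'P]%act.
Proof.
have /connected_closed[d allK] := map_connected M.
apply/connected_closed; split=> // K Kf Ke; apply: allK => // d'.
by rewrite nodeE Kf Ke.
Qed.

Definition dual_map (M : surface_map) : surface_map :=
  SurfaceMap (@edgeK M) (@edge_neq M) (dual_connected M).

Lemma face_dual (M : surface_map) : face (dual_map M) = node M.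
Proof. by apply/permP => d; rewrite faceE; exact: esym (@nodeE M d). Qed.

Lemma dual_genus (M : surface_map) g : has_surface_genus M g -> has_surface_genus (dual_map M) g.
Proof.
rewrite /has_surface_genus -[faces (dual_map M)]/(porbits (face (dual_map M))) face_dual.
by rewrite [X in X + _]addnC.
Qed.

Lemma drawn_on_map (G : sgraph) (M M' : surface_map) (i : M -> M') (h : G -> {set M}) :
    injective i -> injective h -> (forall v, h v \in nodes M) ->
    (forall u v, adj u v -> exists d, [/\ d \in h u, edge M d \in h v
       & edge M' (i d) = i (edge M d)]) ->
    (forall v d, d \in h v -> node M' (i d) = i (node M d)) ->
  drawn_on G M'.
Proof.
move=> i_inj h_inj hn ha hi; exists (fun v => i @: h v); split.
- by move=> u v /(imset_inj i_inj)/h_inj.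
- move=> v; have := hn v => /imsetP[d _ hv]; rewrite hv -(@porbit_map _ _ i (node M) (node M')).
    exact: imset_f.
  by move=> y yd; apply: (hi v); rewrite hv.
move=> u v /ha[d [du dv de]]; exists (i d); first exact: imset_f.
by rewrite de imset_f.
Qed.

Definition last_positions n m := iota (n - m) m.

Lemma mem_last_positions n m k : k < n -> n <= k + m -> k \in last_positions n m.
Proof. by rewrite mem_iota; lia. Qed.

(** * A graph drawn on a map of positive genus *)

Section Drawing.
Variables (G : sgraph) (M : surface_map) (g : nat) (h : G -> {set M}).
Hypothesis Mg : has_surface_genus M g.+1.
Hypothesis h_inj : injective h.
Hypothesis h_node : forall v, h v \in nodes M.
Hypothesis h_adj : forall u v, adj u v -> exists2 d, d \in h u & edge M d \in h v.

Let Y : {set M} :=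
  [set d | [exists u, exists v, [&& adj u v, d \in h u & edge M d \in h v]]].

Let YP d : reflect (exists u v, [/\ adj u v, d \in h u & edge M d \in h v]) (d \in Y).
Proof.
rewrite inE; apply: (iffP existsP) => [[u /existsP[v /and3P[]]]|[u [v [? ? ?]]]].
  by exists u, v.
by exists u; apply/existsP; exists v; apply/and3P.
Qed.

Let Y_edge : edge_closed Y.
Proof.
move=> d; apply/YP/YP => -[u [v [uv du dv]]]; exists v, u; rewrite adj_sym.
  by rewrite edgeK in dv.
by rewrite edgeK.
Qed.

Let h_orbit v d : d \in h v -> h v = porbit (node M) d.
Proof. by have /imsetP[d' _ ->] := h_node v => /eq_porbits. Qed.

(** The dual map is cut along a smallest such chain and then dualized back. The vertices of [M] are
    faces of the dual and survive the cut; the edges of [G] survive since they avoid the chain. *)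
Lemma draw_cocycle (z : {set M}) :
    edge_closed z -> [disjoint z & Y] -> even_on (face M) z -> ~~ is_cut (node M) z ->
  embeds_in_genus G g.
Proof.
move=> ze zY zf zn.
have zY' : z \subset ~: Y by rewrite -disjoints_subset.
have [|y [[ye yY yn yc] _ ymin]] := @min_noncut (dual_map M) (~: Y) z ze zY' zf.
  by rewrite face_dual.
have [M' [i [M'g i_inj ie _ iface]]] := cycle_surgery ye yn ymin yc (dual_genus Mg).
exists (dual_map M'); first exact: dual_genus.
apply: (@drawn_on_map G M (dual_map M') i h) => //.
  move=> u v uv; have [d du dv] := h_adj uv; exists d; split=> //; apply: ie.
  by apply/negP => /(subsetP yY); rewrite inE => /negP[]; apply/YP; exists u, v.
by move=> v d _; rewrite iface face_dual.
Qed.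

Section CutCycle.
Variable z : {set M}.
Hypothesis z_edge : edge_closed z.
Hypothesis zY : z \subset Y.
Hypothesis z_even : even_on (node M) z.
Hypothesis z_noncut : ~~ is_cut (face M) z.
Hypothesis z_card : forall w : {set M}, edge_closed w -> w \subset Y -> even_on (node M) w ->
  ~~ is_cut (face M) w -> #|z| <= #|w|.
Hypothesis z_min : forall w : {set M}, w \subset z -> edge_closed w -> even_on (node M) w ->
  w = set0 \/ w = z.

Let A : {set G} := [set v | ~~ [disjoint h v & z]].

Let AP v : reflect (exists2 d, d \in h v & d \in z) (v \in A).
Proof.
rewrite in_set -setI_eq0; apply: (iffP (set0Pn _)) => [[d]|[d dv dz]].
  by rewrite inE => /andP[]; exists d.
by exists d; rewrite inE dv.
Qed.

(** No dart at a remaining vertex lies in [z], so the cut changes neither the rotation there nor the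
    edges leaving it. *)
Lemma draw_delete_cycle : embeds_in_genus (delete_set A) g.
Proof.
have [M' [i [M'g i_inj ie inode _]]] := cycle_surgery z_edge z_even z_min z_noncut Mg.
exists M' => //; pose h' (v : delete_set A) := h (val v).
have off (v : delete_set A) d : d \in h' v -> d \notin z.
  by move=> dv; apply/negP => dz; have := valP v => /negP[]; apply/AP; exists d.
apply: (@drawn_on_map _ M M' i h') => //.
- by move=> u v /h_inj/val_inj.
- by move=> v; apply: h_node.
- move=> u v /h_adj[d du dv]; exists d; split=> //; apply: ie; exact: off du.
by move=> v d /off; apply: inode.
Qed.

(* A path [w] of length [m] in the drawing joining two vertices of the cycle
   gives two closed walks with it, one of which is not a boundary. *)
Lemma shortcut (t : {perm M}) c k (w : {set M}) m :
    involutive t -> (forall d, t d \in porbit (node M) d) ->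
    (forall d, (t d != d) = (d \in z)) -> c \in z ->
    let s := (edge M * t)%g in let n := #|porbit s c| in
    k <= n -> edge_closed w -> w \subset Y -> #|w| <= m.*2 ->
    (forall d, parity (porbit (node M) d) w =
       (c \in porbit (node M) d) (+) (iter k s c \in porbit (node M) d)) ->
  k <= m \/ n <= k + m.
Proof.
move=> tK tn tz cz s n kn we wY wm wp; pose a := cycle_arc t c k.
have ae : edge_closed a by apply: arc_edge.
have az : a \subset z by apply: (arc_sub z_edge tK tz).
have Ea : even_on (node M) (symdiff a w).
  apply/forallP => d; rewrite -/(parity _ _) parity_symdiff parity_arc // wp.
  by rewrite addbb.
have subY (x y : {set M}) : x \subset Y -> y \subset Y -> symdiff x y \subset Y.
  move=> xY yY; apply/subsetP => d; rewrite in_symdiff.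
  by case: (boolP (d \in x)) => [/(subsetP xY)//|_ /(subsetP yY)].
have aY := subset_trans az zY.
have zn : #|z| = n.*2 := card_cycle z_edge z_even z_min z_noncut tK tn tz cz.
(* If the arc closed up by [w] does not bound, it is at least as long as [z]; counted in darts,
   [2 n <= 2 k + 2 m]. *)
have [awc|awc] := boolP (is_cut (face M) (symdiff a w)); last first.
  right; have := z_card (edge_closed_symdiff ae we) (subY _ _ aY wY) Ea awc.
  rewrite zn => /leq_trans/(_ (card_symdiff _ _)).
  by move=> /leq_trans/(_ (leq_add (card_arc t c k) wm)); rewrite -doubleD leq_double.
(* Otherwise the complementary arc closed up by [w] is the sum of [z] and a boundary, so it does not
   bound, and [2 n <= 2 (n - k) + 2 m]. *)
left; have bE : symdiff z (symdiff a w) = symdiff (symdiff z a) w.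
  by apply/setP => d; rewrite !in_symdiff addbA.
have za : #|symdiff z a| <= (n - k).*2 :=
  card_arc_compl z_edge z_even z_min z_noncut tK tn tz cz kn.
have := card_symdiff (symdiff z a) w; rewrite -bE => zaw.
suff : #|z| <= #|symdiff z (symdiff a w)|.
  rewrite zn => /leq_trans/(_ zaw)/leq_trans/(_ (leq_add za wm)).
  by rewrite -doubleD leq_double -{1}(subnK kn) leq_add2l.
apply: z_card.
- by apply: (edge_closed_symdiff z_edge); apply: edge_closed_symdiff.
- by apply: (subY _ _ zY); apply: subY.
- exact: even_on_symdiff.
apply: contra z_noncut => zawc; rewrite -(symdiff_addKl (symdiff a w) z).
by apply: is_cut_symdiff => //; rewrite symdiffC.
Qed.

Let dart_pair d : {set M} := symdiff [set d] [set edge M d].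

Let dart_pair_edge d : edge_closed (dart_pair d).
Proof.
move=> x; rewrite !in_symdiff !in_set1 (inj_eq perm_inj).
by rewrite (can2_eq (edgeK (s := M)) (edgeK (s := M))) addbC.
Qed.

Let dart_pair_sub d : d \in Y -> dart_pair d \subset Y.
Proof.
move=> dY; apply/subsetP => x; rewrite in_symdiff !in_set1.
by case: eqP => [->|_ /= /eqP->] //; rewrite Y_edge.
Qed.

Let card_dart_pair d : #|dart_pair d| <= 2.
Proof. by apply: leq_trans (card_symdiff _ _) _; rewrite !cards1. Qed.

Let orbit_h v d e : d \in h v -> (d \in porbit (node M) e) = (h v == porbit (node M) e).
Proof. by move=> dv; rewrite -eq_porbit_mem -(h_orbit dv). Qed.

Lemma cycle_position (t : {perm M}) c b :
    involutive t -> (forall d, t d \in porbit (node M) d) ->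
    (forall d, (t d != d) = (d \in z)) -> c \in z -> b \in A ->
    let s := (edge M * t)%g in
  exists2 k, k < #|porbit s c| & iter k s c \in h b.
Proof.
move=> tK tn tz cz /AP[d db dz] s.
have [k kn dk] := arc_cover z_edge z_even z_min z_noncut tK tn tz cz dz.
by exists k => //; rewrite (h_orbit db) porbit_sym.
Qed.

(** As [h] is injective, one position on the cycle serves at most one vertex of [G]. *)
Let card_positions (B : {set G}) (x : nat -> M) (r : seq nat) :
    (forall b, b \in B -> exists2 k, k \in r & x k \in h b) -> #|B| <= size r.
Proof.
elim: r B => [|k r IHr] B Br.
  by rewrite leqn0 cards_eq0; apply/set0Pn => -[b /Br[]].
pose B' := [set b in B | x k \notin h b].
have /IHr leB' : forall b, b \in B' -> exists2 k, k \in r & x k \in h b.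
  move=> b; rewrite inE => /andP[/Br[j]]; rewrite inE => /orP[/eqP->|jr] jb.
    by rewrite jb.
  by exists j.
rewrite -(cardsID [set b | x k \in h b] B) /= -add1n; apply: leq_add.
  apply/card_le1_eqP => a b; rewrite !inE => /andP[_ ka] /andP[_ kb].
  by apply: h_inj; rewrite (h_orbit ka) (h_orbit kb).
by apply: leq_trans leB'; apply/subset_leq_card/subsetP => b; rewrite !inE andbC.
Qed.

(** With [a] at position 0, an edge from [a] to [b] is a path of length 1, so by [shortcut] the
    vertex [b] can only be at position 1 or [n - 1]. *)
Lemma cycle_inner a : a \in A -> #|[set b in A | adj a b]| <= 2.
Proof.
move=> aA; have /AP[c ca cz] := aA.
have [t [tK tn tz]] := cycle_pairing z_even.
pose s := (edge M * t)%g; pose n := #|porbit s c|.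
apply: (@card_positions _ (fun k => iter k s c) ([:: 1] ++ last_positions n 1)) => b.
rewrite inE => /andP[bA ab]; have [k kn kb] := cycle_position tK tn tz cz bA.
exists k => //; have k_gt0 : 0 < k.
  rewrite lt0n; apply: contraTneq ab => k0; rewrite k0 in kb.
  by rewrite (h_inj (_ : h a = h b)) ?adj_irrefl // (h_orbit ca) (h_orbit kb).
have [d da db] := h_adj ab.
have [||||||] := @shortcut t c k (dart_pair d) 1 tK tn tz cz; last 2 first.
- by move=> k1; rewrite mem_cat inE eqn_leq k1 k_gt0.
- by move=> nk; rewrite mem_cat (mem_last_positions kn nk) orbT.
- exact: ltnW.
- exact: dart_pair_edge.
- by apply: dart_pair_sub; apply/YP; exists a, b.
- exact: card_dart_pair.
by move=> e; rewrite parity_symdiff !parity1 !(orbit_h _ da, orbit_h _ db, orbit_h _ ca, orbit_h _ kb).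
Qed.

(** With one neighbor [a] of [v] at position 0, any other is joined to [a] by a path of length 2
    through [v]. This leaves the positions 0, 1, 2, [n - 2] and [n - 1]. *)
Lemma cycle_outer v : v \notin A -> #|[set b in A | adj v b]| <= 5.
Proof.
move=> vA; have [->|[a]] := set_0Vmem [set b in A | adj v b]; first by rewrite cards0.
rewrite inE => /andP[aA va]; have /AP[c ca cz] := aA.
have [t [tK tn tz]] := cycle_pairing z_even.
pose s := (edge M * t)%g; pose n := #|porbit s c|.
apply: (@card_positions _ (fun k => iter k s c) ([:: 0; 1; 2] ++ last_positions n 2)) => b.
rewrite inE => /andP[bA vb]; have [k kn kb] := cycle_position tK tn tz cz bA.
exists k => //; have [d dv da] := h_adj va; have [e ev eb] := h_adj vb.
have [||||||] := @shortcut t c k (symdiff (dart_pair d) (dart_pair e)) 2 tK tn tz cz; last 2 first.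
- by rewrite mem_cat !inE; clear; case: k => [|[|[|]]].
- by move=> nk; rewrite mem_cat (mem_last_positions kn nk) orbT.
- exact: ltnW.
- by apply: edge_closed_symdiff; apply: dart_pair_edge.
- have dY := dart_pair_sub (introT (YP d) (ex_intro _ v (ex_intro _ a (And3 va dv da)))).
  have eY := dart_pair_sub (introT (YP e) (ex_intro _ v (ex_intro _ b (And3 vb ev eb)))).
  apply/subsetP => x; rewrite in_symdiff.
  by case: (boolP (x \in _)) => [/(subsetP dY)//|_ /(subsetP eY)].
- apply: leq_trans (card_symdiff _ _) _.
  exact: (leq_add (card_dart_pair d) (card_dart_pair e)).
move=> f; rewrite !parity_symdiff !parity1.
rewrite (orbit_h _ dv) (orbit_h _ da) (orbit_h _ ev) (orbit_h _ eb) (orbit_h _ ca) (orbit_h _ kb).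
by rewrite addbACA addbb.
Qed.

End CutCycle.

Lemma draw_reduce : embeds_in_genus G g \/ exists A : {set G},
  [/\ forall a, a \in A -> #|[set b in A | adj a b]| <= 2,
      forall v, v \notin A -> #|[set b in A | adj v b]| <= 5
    & embeds_in_genus (delete_set A) g].
Proof.
have [[z0 [ze zY zn zc]]|[z [ze zY zf zc]]] := cycle_or_cocycle Mg Y_edge; last first.
  by left; apply: draw_cocycle zc.
right; have [z [[{}ze {}zY {}zn {}zc] z_card z_min]] := min_noncut ze zY zn zc.
exists [set v | ~~ [disjoint h v & z]]; split.
- exact: cycle_inner.
- exact: cycle_outer.
exact: draw_delete_cycle.
Qed.

End Drawing.

Lemma genus_reduce (G : sgraph) g : embeds_in_genus G g.+1 ->
  embeds_in_genus G g \/ exists A : {set G},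
  [/\ forall a, a \in A -> #|[set b in A | adj a b]| <= 2,
      forall v, v \notin A -> #|[set b in A | adj v b]| <= 5
    & embeds_in_genus (delete_set A) g].
Proof. by case=> M Mg [h [h_inj hn ha]]; apply: draw_reduce Mg h_inj hn ha. Qed.

(** * The one-vertex graph *)

Definition point : sgraph :=
  @SGraph unit (fun _ _ => false) (fun _ _ => erefl) (fun _ => erefl).

(** The vertex guesses all [s] colors. Since [point] is planar, this yields [s < f s] for positive
    [s]. *)
Lemma HG_point s : s <= HG point s.
Proof.
apply: HG_max; apply/hat_winnableP; exists (fun _ _ => setT).
split=> [v c|phi]; first by rewrite cardsT card_ord.
by exists tt; rewrite inE.
Qed.

Lemma negb_neq (b : bool) : perm (can_inj negbK) b != b.
Proof. by rewrite permE; case: b. Qed.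

Lemma single_edge_connected :
  [transitive <<[set 1; perm (can_inj negbK)]>>%g, on [set: bool] | 'P]%act.
Proof.
apply/connected_closed; split=> [|K _ Ke]; first by exists true.
have K2 : (false \in K) = (true \in K) by rewrite -(Ke true) permE.
case: (boolP (true \in K)) => Kt; [right|left]; apply/setP => -[]; rewrite inE ?K2 //.
  exact: negbTE.
exact: negbTE.
Qed.

Lemma permK_negb : involutive (perm (can_inj negbK)).
Proof. by move=> b; rewrite !permE negbK. Qed.

(** The sphere with two vertices, one edge and one face. A map has at least one dart, so [point] is
    drawn as one end of an edge. *)
Definition single_edge : surface_map := SurfaceMap permK_negb negb_neq single_edge_connected.

Lemma point_planar : planar point.
Proof.
have E : #|edges single_edge|.*2 = 2.
  by rewrite card_porbits_involution ?card_bool //; [apply: permK_negb|apply: negb_neq].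
have N : #|nodes single_edge| = 2.
  rewrite /nodes card_imset ?card_bool // => a b /eqP.
  by rewrite eq_porbit_mem => /porbitP[n ->]; rewrite expg1n perm1.
exists single_edge.
  rewrite /has_surface_genus N /faces /= mulg1 -/(edges single_edge).
  lia.
exists (fun _ => porbit (node single_edge) true); split=> //.
- by case=> -[].
- by move=> _; apply: imset_f.
Qed.

(** * The induction on the genus *)

Theorem theorem5p2 (f : nat -> nat)
    (f_pos : forall s : nat, 0 < s -> 0 < f s)
    (f_planar : forall H : sgraph, planar H ->
       forall s : nat, 0 < s -> HG H s < f s)
    (g s : nat) (s_pos : 0 < s)
    (G : sgraph) (G_genus : graph_genus G g) :
  HG G s < f (3 ^ (2 * (6 ^ g - 1)) * s ^ (6 ^ g)).
Proof.
case: G_genus => G_genus _; elim: g s s_pos G G_genus => [|g IHg] s s_pos G G_genus.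
  by rewrite muln0 expn0 mul1n expn1; apply: f_planar.
pose t := s * (9 * s) ^ 5.
have t_pos : 0 < t by rewrite muln_gt0 s_pos expn_gt0 muln_gt0 s_pos.
have st : s <= t by rewrite leq_pmulr // expn_gt0 muln_gt0 s_pos.
(* Since [t = 3 ^ 10 * s ^ 6], the exponent of 3 on the right is [2 (6 ^ g - 1) + 10 * 6 ^ g], which
   is [12 * 6 ^ g - 2]. *)
have -> : 3 ^ (2 * (6 ^ g.+1 - 1)) * s ^ (6 ^ g.+1) =
          3 ^ (2 * (6 ^ g - 1)) * t ^ (6 ^ g).
  have -> : t = 3 ^ 10 * s ^ 6.
    by rewrite /t expnMn -[9]/(3 ^ 2) -expnM mulnCA -expnS.
  rewrite expnMn -!expnM mulnA -expnD -expnS; congr (3 ^ _ * _).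
  have : 0 < 6 ^ g by rewrite expn_gt0.
  by rewrite expnS; lia.
have [G_g|[A [inner outer A_g]]] := genus_reduce G_genus.
  by apply: leq_ltn_trans (IHg t t_pos G G_g); apply: HG_mono.
set N := 3 ^ _ * _ in IHg *.
(* Deleting [A] requires [L = 9 s] colors among the [HG G s] available ones. With fewer,
   [HG G s < 9 s <= t <= N], and the one-vertex graph gives [N < f N]. *)
have [small|big] := ltnP (HG G s) (9 * s).
  have N_pos : 0 < N by rewrite muln_gt0 !expn_gt0 t_pos.
  apply: leq_trans (f_planar _ point_planar _ N_pos); rewrite ltnS.
  apply: leq_trans (HG_point N); apply: leq_trans (ltnW small) _.
  apply: (@leq_trans t).
    by rewrite /t expnS mulnCA leq_pmulr // muln_gt0 s_pos expn_gt0 muln_gt0 s_pos.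
  apply: (@leq_trans (t ^ (6 ^ g))); last by rewrite leq_pmull // expn_gt0.
  by rewrite -{1}[t]expn1 leq_pexp2l // expn_gt0.
apply: leq_ltn_trans (IHg t t_pos _ A_g); apply: HG_max.
apply: (hat_winnable_delete_set inner outer _ _ big); rewrite ?muln_gt0 //.
(* [G] has a vertex because [0 < 9 s <= HG G s <= s * #|G|]. *)
apply: HG_winnable; rewrite -(@ltn_pmul2l s) // muln0.
by apply: leq_trans (HG_bound G s); apply: leq_trans big; rewrite muln_gt0.
Qed.
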